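(* Let $\mathcal{H},\mathcal{K}$ be Hilbert spaces, let $\Phi_1,\ldots,\Phi_n:\mathcal{B}(\mathcal{H})\to\mathcal{B}(\mathcal{K})$ be positive linear mappings with $\sum_{i=1}^n\Phi_i(\mathbf{1}_{\mathcal{H}})=\mathbf{1}_{\mathcal{K}}$, let $A_1,\ldots,A_n,B_1,\ldots,B_n\in\mathcal{B}(\mathcal{H})$ be self-adjoint operators with spectra contained in the interval $J$, and let $f\in C^1_{\mathrm{co}}(J)$. Then $$\sum_{i=1}^n\Phi_i(f(A_i))\le f\left(\sum_{i=1}^n\Phi_i(B_i)\right)+\theta\,\mathbf{1}_{\mathcal{K}},$$ where $$\theta=\sup_{x\in\mathcal{K},\ \|x\|=1}\left\{\left\langle\sum_{i=1}^n\Phi_i(f'(A_i)A_i)x,x\right\rangle-\left\langle\sum_{i=1}^n\Phi_i(f'(A_i))x,x\right\rangle\left\langle\sum_{i=1}^n\Phi_i(B_i)x,x\right\rangle\right\}.$$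
   Context: $\mathcal{B}(\mathcal{H})$ is the $C^*$-algebra of bounded linear operators on a (complex) Hilbert space $\mathcal{H}$, with identity $\mathbf{1}_{\mathcal{H}}$. An operator $A$ is positive ($A\ge 0$) if $\langle Ax,x\rangle\ge 0$ for all $x\in\mathcal{H}$; for self-adjoint $A,B$, $A\le B$ means $B-A\ge 0$. A linear map $\Phi:\mathcal{B}(\mathcal{H})\to\mathcal{B}(\mathcal{K})$ is positive if $\Phi(A)\ge 0$ whenever $A\ge 0$. $C^1_{\mathrm{co}}(J)$ denotes the class of differentiable convex real functions on the interval $J\subseteq\mathbb{R}$ (one-sided derivatives at endpoints belonging to $J$); $f'$ is the derivative of $f$. For a self-adjoint operator $T$ with spectrum in $J$, $f(T)$ and $f'(T)$ are defined by the continuous functional calculus. *)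

(* Defs.v *)
From HB Require Import structures.
From mathcomp Require Import all_boot all_order all_algebra.
From mathcomp Require Import complex.
From mathcomp Require Import all_classical all_reals all_analysis.

Set Implicit Arguments.
Unset Strict Implicit.
Unset Printing Implicit Defensive.

Import Order.TTheory GRing.Theory Num.Theory.
Import numFieldNormedType.Exports.

Local Open Scope classical_set_scope.
Local Open Scope ring_scope.
Local Open Scope complex_scope.

(* The inner product is linear in its first argument and conjugate-linear in
   its second one, and it induces the (complete) norm. *)
HB.mixin Record CompleteNormedModule_isHilbert (R : realType) H
    of CompleteNormedModule R[i] H := {
  hdot : {dot H for @Num.conj R[i]} ;
  hdot_norm : forall x : H, `|x| ^+ 2 = hdot x x
}.

#[short(type="hilbertType")]
HB.structure Definition Hilbert (R : realType) :=
  {H of CompleteNormedModule_isHilbert R H & CompleteNormedModule R[i] H}.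

Section bounded_operators.
Context {R : realType}.

Definition bounded_op (H K : hilbertType R) : {pred H -> K} :=
  fun f : H -> K => `[< linear f /\
                        exists M : R, forall x, `|f x| <= M%:C * `|x| >].

Arguments bounded_op : clear implicits.

Record bop (H K : hilbertType R) :=
  Bop { bop_fun :> H -> K ; bop_prop : bop_fun \in bounded_op H K }.

HB.instance Definition _ H K := [isSub for @bop_fun H K].
HB.instance Definition _ H K := [Choice of bop H K by <:].

Lemma bopP (H K : hilbertType R) (f : H -> K) :
  linear f -> (exists M : R, forall x, `|f x| <= M%:C * `|x|) ->
  f \in bounded_op H K.
Proof. by move=> lf bf; apply/asboolP. Qed.

Lemma bop_linear (H K : hilbertType R) (T : bop H K) : linear T.
Proof. by have := bop_prop T; move=> /asboolP[]. Qed.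

Lemma bop_bounded (H K : hilbertType R) (T : bop H K) :
  exists M : R, 0 <= M /\ forall x, `|T x| <= M%:C * `|x|.
Proof.
have := bop_prop T; move=> /asboolP[_ [M hM]].
exists `|M|; split=> // x; apply: (le_trans (hM x)).
by rewrite ler_wpM2r// lecR ler_norm.
Qed.

HB.instance Definition _ (H K : hilbertType R) (T : bop H K) :=
  GRing.isLinear.Build R[i] H K *:%R (bop_fun T) (bop_linear T).

Lemma bounded_op_submod (H K : hilbertType R) :
  GRing.submod_closed (bounded_op H K).
Proof.
split.
  apply: bopP; first by move=> a x y; rewrite /GRing.zero/= scaler0 addr0.
  by exists 0 => x; rewrite /GRing.zero/= normr0 mul0r.
move=> a f g /asboolP[lf [M hM]] /asboolP[lg [N hN]].
apply/asboolP; split.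
  move=> b x y; rewrite !fctE lf lg !scalerDr !scalerA (mulrC a b).
  by rewrite addrACA.
exists (complex.Re `|a| * M + N) => x; rewrite !fctE.
apply: (le_trans (ler_normD _ _)).
rewrite normrZ rmorphD rmorphM/= mulrDl lerD// -mulrA.
have -> : (complex.Re `|a|)%:C = `|a| by rewrite RRe_real// normr_real.
by rewrite ler_wpM2l.
Qed.

HB.instance Definition _ (H K : hilbertType R) :=
  GRing.isSubmodClosed.Build R[i] (H -> K) (bounded_op H K)
    (bounded_op_submod H K).
HB.instance Definition _ (H K : hilbertType R) :=
  [SubChoice_isSubLmodule of bop H K by <:].

Lemma bop_id_subproof (H : hilbertType R) :
  (fun x : H => x) \in bounded_op H H.
Proof. by apply: bopP => [//|]; exists 1 => x; rewrite mul1r. Qed.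

Definition bop_id (H : hilbertType R) : bop H H := Bop (bop_id_subproof H).

Lemma bop_comp_subproof (H K L : hilbertType R) (S : bop K L) (T : bop H K) :
  (fun x => S (T x)) \in bounded_op H L.
Proof.
apply: bopP => [a x y|]; first by rewrite !linearP.
have [M [M0 hM]] := bop_bounded S; have [N [N0 hN]] := bop_bounded T.
exists (M * N) => x; apply: (le_trans (hM _)).
by rewrite rmorphM/= -mulrA ler_wpM2l// lecR.
Qed.

Definition bop_comp (H K L : hilbertType R) (S : bop K L) (T : bop H K) :
  bop H L := Bop (bop_comp_subproof S T).

Lemma bop_eq (H K : hilbertType R) (S T : bop H K) : S =1 T -> S = T.
Proof. by move=> ST; apply/val_inj/funext. Qed.

Section ring.
Variable H : hilbertType R.

Let compA : associative (@bop_comp H H H).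
Proof. by move=> S T U; apply: bop_eq. Qed.
Let comp1l : left_id (bop_id H) (@bop_comp H H H).
Proof. by move=> S; apply: bop_eq. Qed.
Let comp1r : right_id (bop_id H) (@bop_comp H H H).
Proof. by move=> S; apply: bop_eq. Qed.
Let compDl : left_distributive (@bop_comp H H H) +%R.
Proof. by move=> S T U; apply: bop_eq. Qed.
Let compDr : right_distributive (@bop_comp H H H) +%R.
Proof. by move=> S T U; apply: bop_eq => x /=; rewrite linearD. Qed.

(* Only a [pzRingType]: 1 = 0 on the zero space. *)
HB.instance Definition _ := GRing.Zmodule_isPzRing.Build (bop H H)
  compA comp1l comp1r compDl compDr.
End ring.

End bounded_operators.

Notation "''B' ( H , K )" := (bop H K)
  (at level 8, format "''B' ( H ,  K )") : type_scope.
Notation "''B' ( H )" := (bop H H)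
  (at level 8, format "''B' ( H )") : type_scope.

Section operators.
Context {R : realType}.
Implicit Types H K : hilbertType R.

Definition selfadjoint H (T : 'B(H)) : Prop :=
  forall x y, hdot (T x) y = hdot x (T y).

(* In the order of [R[i]], [0 <= z] means that z is real and nonnegative. *)
Definition posop H (T : 'B(H)) : Prop := forall x, 0 <= hdot (T x) x.

Definition leop H (S T : 'B(H)) : Prop := posop (T - S).

Definition positive_map H K (Phi : 'B(H) -> 'B(K)) : Prop :=
  forall T, posop T -> posop (Phi T).

Definition invertible_op H (T : 'B(H)) : Prop :=
  exists S : 'B(H), S * T = 1 /\ T * S = 1.

Definition spectrum H (T : 'B(H)) : set R[i] :=
  [set l | ~ invertible_op (T - l *: (1 : 'B(H)))].

Definition spectrum_in H (T : 'B(H)) (J : interval R) : Prop :=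
  spectrum T `<=` [set t%:C | t in [set` J]].

Definition opnorm H (T : 'B(H)) : R :=
  sup [set complex.Re `|T x| | x in [set x | `|x| <= 1]].

Definition poly_op H (T : 'B(H)) (p : {poly R}) : 'B(H) :=
  \sum_(i < size p) (p`_i)%:C *: T ^+ i.

(* Continuous functional calculus of a self-adjoint T: f(T) is the limit in
   operator norm of p_n(T) for polynomials p_n converging to f uniformly on the
   spectrum of T (which is real).  When f is continuous on the spectrum such a
   limit exists and does not depend on the p_n; otherwise there is none and the
   value 0 is meaningless. *)
Definition cfc_lim H (T : 'B(H)) (f : R -> R) (S : 'B(H)) : Prop :=
  exists p : nat -> {poly R},
    {uniform [set t : R | spectrum T t%:C],
       (fun n t => (p n).[t]) @ \oo --> f} /\
    opnorm (poly_op T (p n) - S) @[n --> \oo] --> (0 : R).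

Definition cfc H (T : 'B(H)) (f : R -> R) : 'B(H) := xget 0 (cfc_lim T f).

End operators.

Section C1co.
Context {R : realType}.

(* The increments h are restricted by [t + h \in J], so that the derivative is
   one-sided at an endpoint belonging to J. *)
Definition diff_quotient_in (J : interval R) (f : R -> R) (t : R) :
    set_system R :=
  (fun h => h^-1 * (f (t + h) - f t)) @ within [set h | t + h \in J] 0^'.

Definition derivable_in (J : interval R) (f : R -> R) : Prop :=
  forall t, t \in J -> cvg (diff_quotient_in J f t).

Definition derive_in (J : interval R) (f : R -> R) (t : R) : R :=
  lim (diff_quotient_in J f t).

Definition C1co (J : interval R) (f : R -> R) : Prop :=
  derivable_in J f /\ @convex_function R R^o [set` J] f.

End C1co.

(* Main.v *)
(* For s, t in J the tangent inequality f s + f' s (t - s) <= f t of the convex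
   function f gives, by the functional calculus in s = A_i,
     f(A_i) <= f(t) 1 + f'(A_i) A_i - t f'(A_i).
   Apply Phi_i and sum over i.  For a unit vector x take t = <S x, x> with
   S = sum_i Phi_i(B_i); t lies in J because the numerical range of S does.  The
   right-hand side is then at most f(t) + theta at x, and the tangent inequality
   at t, applied to S, gives f(t) <= <f(S) x, x>.

   The functional calculus rests on one fact: if T is self-adjoint and the real
   polynomial p is nonnegative on the spectrum of T, then p(T) >= 0.  Otherwise
   m := inf <p(T) x, x> is negative, p(T) - m is not bounded below, hence not
   invertible; factoring p - m over the complex numbers, some T - z with
   p(z) = m is not invertible, and z is real because T is self-adjoint. *)

Require Import Defs.
From HB Require Import structures.
From mathcomp Require Import all_boot all_order all_algebra.
From mathcomp Require Import complex ring lra.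
From mathcomp Require Import all_classical all_reals all_analysis.
Set Implicit Arguments.
Unset Strict Implicit.
Unset Printing Implicit Defensive.

Import Order.TTheory GRing.Theory Num.Theory.
Import numFieldNormedType.Exports.
Local Open Scope classical_set_scope.
Local Open Scope ring_scope.
Local Open Scope complex_scope.

(** * Weierstrass approximation by Bernstein polynomials *)

Section bernstein.
Context {R : realType}.
Implicit Types (x : R) (g : R -> R) (n : nat).

Definition bernstein_weight n (k : nat) x : R :=
  (1 - x) ^+ (n - k) * x ^+ k *+ 'C(n, k).

Definition bernstein n g : {poly R} :=
  \sum_(k < n.+1)
    (g (k%:R / n%:R) *+ 'C(n, k)) *: ((1 - 'X) ^+ (n - k) * 'X^k).

Lemma bernsteinE n g x :
  (bernstein n g).[x] =
  \sum_(k < n.+1) bernstein_weight n k x * g (k%:R / n%:R).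
Proof.
rewrite /bernstein horner_sum; apply: eq_bigr => k _.
rewrite /bernstein_weight !hornerE /=.
by rewrite !mulrnAl -mulrA mulrC.
Qed.

Lemma bernstein_weight_ge0 n k x : 0 <= x <= 1 -> 0 <= bernstein_weight n k x.
Proof.
by move=> /andP[x0 x1]; rewrite mulrn_wge0// mulr_ge0 ?exprn_ge0// subr_ge0.
Qed.

Lemma sum_bernstein_weight n x : \sum_(k < n.+1) bernstein_weight n k x = 1.
Proof. by rewrite -exprDn subrK expr1n. Qed.

(* The moments are obtained by differentiating [(c + 'X) ^+ n] at [x] and then
   setting [c = 1 - x]. *)
Lemma bernstein_moments n x :
  \sum_(k < n.+1) bernstein_weight n k x * k%:R = n%:R * x /\
  \sum_(k < n.+1) bernstein_weight n k x * (k%:R * (k%:R - 1))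
    = n%:R * (n%:R - 1) * x ^+ 2.
Proof.
pose q : {poly R} := (1 - x)%:P + 'X.
have qx (m : nat) : (q ^+ m).[x] = 1 by rewrite !hornerE subrK expr1n.
have dq (m : nat) : deriv (q ^+ m) = q ^+ m.-1 *+ m.
  by rewrite deriv_exp derivD derivC derivX add0r mul1r.
(* At [m = 0] the truncated predecessor does no harm, since both sides vanish. *)
have predE (m : nat) : m%:R * m.-1%:R = m%:R * (m%:R - 1) :> R.
  by case: m => [|m]; rewrite ?mul0r// -[in m.+1%:R - 1]natr1 addrK.
have E : q ^+ n = \sum_(k < n.+1) ((1 - x) ^+ (n - k) *+ 'C(n, k)) *: 'X^k.
  rewrite exprDn; apply: eq_bigr => k _.
  by rewrite -polyC_exp mul_polyC scalerMnl.
have Xpred (m : nat) : x ^+ m.-1 * x *+ m = x ^+ m *+ m.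
  by case: m => [|m]; rewrite ?mulr0n// exprSr.
have XXpred (m : nat) :
    x ^+ m.-2 *+ m.-1 *+ m * x ^+ 2 = x ^+ m * (m%:R * m.-1%:R).
  case: m => [|[|m]]; rewrite ?(mul0r,mulr0,mulr0n)//=.
  by rewrite mulrnAl mulrnAl -exprD addn2 mulrA !mulr_natr mulrnAC.
split.
  have := congr1 (fun p => (deriv p).[x] * x) E.
  rewrite /= dq hornerMn qx raddf_sum/= horner_sum mulr_suml => ->.
  apply: eq_bigr => k _.
  rewrite derivZ derivXn !hornerE/= hornerMn hornerXn.
  rewrite -mulrA mulrnAl Xpred /bernstein_weight mulrnAl mulr_natr.
  by rewrite -mulrnAr mulrnAl.
have := congr1 (fun p => (deriv (deriv p)).[x] * x ^+ 2) E.
rewrite /= dq derivMn dq !hornerMn qx !raddf_sum/= horner_sum mulr_suml.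
rewrite -[n.-1%:R *+ n]mulr_natl predE => ->.
apply: eq_bigr => k _; rewrite derivZ derivXn derivZ derivMn derivXn.
rewrite hornerZ !hornerMn hornerXn -predE /bernstein_weight.
by rewrite -[X in X * _ = _]mulrnAl -[LHS]mulrA -XXpred mulrA.
Qed.

Lemma bernstein_variance n x :
  \sum_(k < n.+1) bernstein_weight n k x * (k%:R - n%:R * x) ^+ 2
    = n%:R * (x * (1 - x)).
Proof.
have [m1 m2] := bernstein_moments n x.
(* The square is expanded as [k (k - 1) + (1 - 2 n x) k + (n x)^2], so that the moments apply to
   each term. *)
transitivity (\sum_(k < n.+1) (bernstein_weight n k x * (k%:R * (k%:R - 1))
  + (1 - n%:R * x *+ 2) * (bernstein_weight n k x * k%:R)
  + (n%:R * x) ^+ 2 * bernstein_weight n k x)).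
  apply: eq_bigr => k _.
  by move: (bernstein_weight n k x) (k%:R : R) (n%:R : R) => w r s; ring.
rewrite 2!big_split/= -!mulr_sumr m1 m2 sum_bernstein_weight.
by move: (n%:R : R) => r; ring.
Qed.

(** For [s] near [t] uniform continuity gives [e]; for [s] far from [t] the quadratic term exceeds
    twice a bound of [|g|]. A quadratic term is chosen because its Bernstein average is the
    variance. *)
Lemma quadratic_modulus (A : set R) g : compact A -> {within A, continuous g} ->
  forall e : R, 0 < e -> exists C : R, 0 <= C /\
    forall s t, A s -> A t -> `|g s - g t| <= e + C * (s - t) ^+ 2.
Proof.
move=> cA cg e e0.
have [M [_ HM]] := compact_bounded (continuous_compact cg cA).
have {}HM : forall s, A s -> `|g s| <= `|M| + 1.
  by move=> s As; apply: (HM (`|M| + 1));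
    [rewrite ltr_pwDr// ler_norm|exists s].
move: HM; set N : R := `|M| + 1 => HM.
(* By compactness it is enough to find, around each point of [A], a neighbourhood on which every
   large [C] works. *)
have := (near_covering_withinP A).2 ((compact_near_coveringP A).1 cA) R
   (pinfty_nbhs R) (fun C t => forall s, A s ->
     `|g s - g t| <= e + C * (s - t) ^+ 2).
case; last first.
  move=> C0 [_ H0]; exists (`|C0| + 1); split; first by rewrite addr_ge0.
  by move=> s t As At; apply: H0 => //; rewrite ltr_pwDr// ler_norm.
move=> x Ax; have /subspace_continuousP/(_ x Ax) := cg.
have e20 : 0 < e / 2 by rewrite divr_gt0.
move=> /cvgrPdist_lt/(_ _ e20); rewrite near_withinE => /nbhs_ballP[d /= d0 Hd].
have {}Hd t : A t -> `|x - t| < d -> `|g x - g t| < e / 2.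
  by move=> At xt; apply: Hd.
have d20 : 0 < d / 2 by rewrite divr_gt0.
near=> t C => /= At s As.
have xt : `|x - t| < d / 2.
  near: t; exact: (nbhsx_ballx x (d / 2) d20).
have CN : 2 * N / (d / 2) ^+ 2 <= C.
  by near: C; apply: nbhs_pinfty_ge; rewrite num_real.
have N0 : 0 <= N by rewrite addr_ge0.
have C0 : 0 <= C by rewrite (le_trans _ CN)// divr_ge0 ?sqr_ge0 ?mulr_ge0.
(* Either [s] and [t] both lie where [g] is within [e / 2] of [g x], or [|s - t|] is at least
   [d / 2] and [C (d / 2)^2] is at least [2 N]. *)
have [xs|sx] := ltP `|x - s| d.
  rewrite ler_wpDr ?(mulr_ge0 C0 (sqr_ge0 _))//.
  rewrite (_ : g s - g t = (g x - g t) - (g x - g s)); last by ring.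
  rewrite (le_trans (ler_normB _ _))// (splitr e) ltW// ltrD//; apply: Hd => //.
have st : (d / 2) ^+ 2 <= (s - t) ^+ 2.
  rewrite -[leRHS]real_normK ?num_real// lerXn2r ?nnegrE ?(ltW d20)//.
  have := ler_distD t x s; rewrite (distrC t s) => xts; lra.
rewrite (le_trans (ler_normB _ _))//.
apply: (@le_trans _ _ (C * (s - t) ^+ 2)); last by rewrite lerDr ltW.
apply: (@le_trans _ _ (2 * N / (d / 2) ^+ 2 * (d / 2) ^+ 2)).
  by rewrite divfK ?gt_eqF ?exprn_gt0// mulr2n mulrDl mul1r lerD// HM.
by apply: ler_pM => //; rewrite ?divr_ge0 ?sqr_ge0 ?mulr_ge0.
Unshelve. all: by end_near.
Qed.

(** The error at [x] is the weighted average of [g (k / n) - g x], hence at most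
    [e / 2 + (C / n^2) n x (1 - x)]; [n] is chosen with [C / n <= e / 2]. *)
Lemma weierstrass01 g : {within `[0, 1], continuous g} ->
  forall e : R, 0 < e -> exists p : {poly R},
    forall x, 0 <= x <= 1 -> `|p.[x] - g x| <= e.
Proof.
move=> cg e e0; have e20 : 0 < e / 2 by rewrite divr_gt0.
have [C [C0 HC]] := quadratic_modulus (@segment_compact _ _ _) cg e20.
pose n := (Num.bound (C / (e / 2))).+1.
have n0 : (0 : R) < n%:R by rewrite ltr0n.
have Cn : C / n%:R <= e / 2.
  rewrite ler_pdivrMr// mulrC -ler_pdivrMr// ltW//.
  by rewrite (lt_trans (archi_boundP _)) ?divr_ge0 ?ltr_nat// ltW.
exists (bernstein n g) => x x01.
have -> : (bernstein n g).[x] - g x =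
    \sum_(k < n.+1) bernstein_weight n k x * (g (k%:R / n%:R) - g x).
  rewrite bernsteinE -[in LHS](mul1r (g x)) -(sum_bernstein_weight n x)
    mulr_suml.
  by rewrite -sumrB; apply: eq_bigr => k _; rewrite mulrBr.
apply: (@le_trans _ _ (\sum_(k < n.+1) (bernstein_weight n k x * (e / 2)
    + C / n%:R ^+ 2 * (bernstein_weight n k x * (k%:R - n%:R * x) ^+ 2)))).
  apply: le_trans (ler_norm_sum _ _ _) _; apply: ler_sum => k _.
  have w0 := bernstein_weight_ge0 n k x01.
  have -> : C / n%:R ^+ 2 * (bernstein_weight n k x * (k%:R - n%:R * x) ^+ 2) =
      bernstein_weight n k x * (C * (k%:R / n%:R - x) ^+ 2).
    move: (bernstein_weight n k x) => w; field; by rewrite gt_eqF.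
  rewrite normrM ger0_norm// -mulrDr ler_wpM2l//; apply: HC => //=.
  by rewrite in_itv/= divr_ge0//= ler_pdivrMr// mul1r ler_nat -ltnS.
rewrite big_split/= -mulr_suml -mulr_sumr sum_bernstein_weight
  bernstein_variance.
rewrite mul1r [leRHS]splitr lerD2l (le_trans _ Cn)//.
have -> : C / n%:R ^+ 2 * (n%:R * (x * (1 - x))) = C / n%:R * (x * (1 - x)).
  by field; rewrite gt_eqF.
by rewrite ler_piMr ?divr_ge0 ?(ltW n0)//; move/andP: x01 => [? ?]; nra.
Qed.

Lemma weierstrass (a b : R) g : {within `[a, b], continuous g} ->
  forall e : R, 0 < e -> exists p : {poly R},
    forall x, a <= x <= b -> `|p.[x] - g x| <= e.
Proof.
move=> cg e e0; have [ba|ab|<-] := ltgtP b a.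
- by exists 0 => x /andP[ax xb]; have := le_lt_trans (le_trans ax xb) ba;
  rewrite ltxx.
- have ba0 : 0 < b - a by rewrite subr_gt0.
  have [|p Hp] := @weierstrass01 (fun u => g (a + (b - a) * u)) _ e e0.
    apply/subspace_continuousP => u /= u01.
    have au : `[a, b]%classic (a + (b - a) * u).
      by move: u01; rewrite /= !in_itv/= => /andP[? ?]; apply/andP; split; nra.
    have /subspace_continuousP/(_ _ au) cgu := cg.
    have c01 x : x \in `[0, 1] -> a + (b - a) * x \in `[a, b].
      by rewrite !in_itv/= => /andP[? ?]; apply/andP; split; nra.
    have cl : a + (b - a) * x @[x --> u] --> a + (b - a) * u.
      by apply: cvgD; [exact: cvg_cst|apply: cvgM;
        [exact: cvg_cst|exact: cvg_id]].
    apply: cvg_comp cgu => P HP; have := cl _ HP.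
    rewrite !nbhs_simpl /within/=; apply: filterS => x /= Px x01.
    exact/Px/c01.
  exists (p \Po ((b - a)^-1 *: ('X - a%:P))) => x /andP[ax xb].
  have := Hp ((b - a)^-1 * (x - a));
    rewrite mulVKf ?gt_eqF// [a + _]addrC subrK.
  rewrite horner_comp !hornerE/=; apply;
    rewrite mulrC divr_ge0 ?subr_ge0 ?(ltW ab)//=.
  by rewrite ler_pdivrMr// mul1r lerB.
- exists (g b)%:P => x; rewrite -eq_le => /eqP <-.
  by rewrite hornerC subrr normr0 ltW.
Qed.

End bernstein.

(** * Differentiable convex functions on an interval *)

Section C1_convex.
Context {R : realType}.
Context (J : interval R) (f : R -> R) (fJ : C1co J f).
Let f' := derive_in J f.

Lemma derive_inP t : t \in J -> forall e : R, 0 < e -> exists2 d : R, 0 < d &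
  forall h, h != 0 -> `|h| < d -> t + h \in J ->
    `|f (t + h) - f t - f' t * h| <= e * `|h|.
Proof.
move=> tJ e e0; have /cvgrPdist_lt/(_ _ e0) : diff_quotient_in J f t --> f' t.
  exact: fJ.1.
rewrite near_withinE /= /dnbhs near_withinE => /nbhs_ballP[d /= d0 Hd].
exists d => // h h0 hd thJ; have {}Hd : `|f' t - h^-1 * (f (t + h) - f t)| < e.
  by apply: Hd => //; rewrite /ball/= sub0r normrN.
rewrite -ler_pdivrMr ?normr_gt0// -normf_div distrC in Hd *.
by rewrite mulrBl mulfK// (mulrC _ h^-1) ltW.
Qed.

(** At [s + l (t - s)] with [l] small, convexity bounds the increment of [f] above by
    [l (f t - f s)], and differentiability bounds it below by [l (f' s (t - s) - e)]. Dividing by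
    [l] and letting [e] vary gives the claim. *)
Lemma C1co_tangent s t : s \in J -> t \in J -> f s + f' s * (t - s) <= f t.
Proof.
move=> sJ tJ; have [->|st] := eqVneq t s; first by rewrite subrr mulr0 addr0.
have ts0 : t - s != 0 by rewrite subr_eq0.
apply/ler_addgt0Pr => e e0;
  have e'0 : 0 < e / `|t - s| by rewrite divr_gt0// normr_gt0.
have [d d0 Hd] := derive_inP sJ e'0.
pose l := Num.min 1 (d / 2 / `|t - s|).
have l0 : 0 < l by rewrite lt_min ltr01 !divr_gt0// normr_gt0.
have l1 : l <= 1 by rewrite ge_min lexx.
have l01 : 0 <= l <= 1 by rewrite l1 ltW.
have lh : `|l * (t - s)| < d.
  rewrite normrM gtr0_norm// -ltr_pdivlMr ?normr_gt0//.
  rewrite (@le_lt_trans _ _ (d / 2 / `|t - s|)) ?ge_min ?lexx ?orbT//.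
  by rewrite ltr_pM2r ?invr_gt0 ?normr_gt0// gtr_pMr// invf_lt1// ltr1n.
have cJ : s + l * (t - s) \in J.
  have iJ := @interval_is_interval _ J.
  have [lt_st|le_ts] := ltP s t.
    apply: (iJ s t) => //=; apply/andP; split; nra.
  apply: (iJ t s) => //=; apply/andP; split; nra.
have := fJ.2 (Itv01 (ltW l0) l1) t s; rewrite !inE => /(_ tJ sJ).
rewrite !convRE/= [conv _ _ _](_ : _ = s + l * (t - s)); last first.
  by transitivity (l * t + (1 - l) * s); [by []|ring].
have := Hd (l * (t - s)); rewrite mulf_neq0 ?ts0 ?gt_eqF// => /(_ isT lh cJ).
have -> : e / `|t - s| * `|l * (t - s)| = l * e.
  by rewrite normrM (gtr0_norm l0) mulrCA divfK ?normr_eq0.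
rewrite ler_norml /unstable.onem.
move=> /andP[Hc _] Hconv; rewrite -(ler_pM2l l0); lra.
Qed.

Lemma C1co_derive_monotone s t : s \in J -> t \in J ->
  0 <= (f' s - f' t) * (s - t).
Proof.
move=> sJ tJ; have := C1co_tangent sJ tJ; have := C1co_tangent tJ sJ; lra.
Qed.

(** Differentiability with error 1 gives [|f s - f t| <= (1 + |f' t|) |s - t|] near [t]. *)
Lemma C1co_continuous : {within [set` J], continuous f}.
Proof.
apply/subspace_continuousP => t /= tJ; apply/cvgrPdist_le => e e0.
have [d d0 Hd] := derive_inP tJ ltr01.
pose c := 1 + `|f' t|; have c0 : 0 < c by rewrite ltr_pwDl.
rewrite near_withinE; near=> s => sJ.
have [->|st] := eqVneq s t; first by rewrite subrr normr0 ltW.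
have := Hd (s - t); rewrite subr_eq0 st [t + _]addrC subrK mul1r => /(_ isT).
have -> : `|s - t| < d.
  by rewrite distrC; near: s; exact: (nbhsx_ballx t d d0).
move=> /(_ isT sJ) Hs; rewrite distrC -(subrK (f' t * (s - t)) (f s - f t)).
rewrite (le_trans (ler_normD _ _))// normrM (@le_trans _ _ (c * `|s - t|))//.
  by rewrite mulrDl mul1r lerD2r.
rewrite mulrC -ler_pdivlMr// distrC ltW//; near: s.
by apply: (nbhsx_ballx t); rewrite divr_gt0.
Unshelve. all: by end_near.
Qed.

(* The cases [u = 1] and [u = -1] are the two halves of the continuity of [f']. *)
Lemma C1co_derive_usc t (u : R) : t \in J -> u * u = 1 -> forall e : R, 0 < e ->
  exists2 d : R, 0 < d & forall s, s \in J -> `|s - t| < d ->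
    u * (f' s - f' t) <= e.
Proof.
move=> tJ uu e e0.
have u2 x : u * (u * x) = x by rewrite mulrA uu mul1r.
(* If [J] has no point on the [u] side of [t], monotonicity of [f'] alone gives the bound. *)
have [[v vJ tv]|Nv] := pselect (exists2 v, v \in J & 0 < u * (v - t));
  last first.
  exists 1 => // s sJ _; have := C1co_derive_monotone sJ tJ.
  have us : u * (s - t) <= 0.
    by rewrite leNgt; apply/negP => us; apply: Nv; exists s.
  have [->|st] := eqVneq s t; first by move=> _; rewrite subrr mulr0 ltW.
  have us0 : u * (s - t) < 0.
    rewrite lt_neqAle us andbT; apply/eqP => /(congr1 ( *%R u)).
    by rewrite u2 mulr0 => /eqP; rewrite subr_eq0 (negPf st).
  rewrite -[s - t]u2 mulrCA mulrA nmulr_lge0// => /le_trans; apply.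
  exact: ltW.
have e20 : 0 < e / 2 by rewrite divr_gt0.
have [d d0 Hd] := derive_inP tJ e20.
(* The point [w = t + u k] lies in [J], beyond every [s] with [|s - t| < k / 2] on the [u] side. *)
pose k := Num.min (d / 2) (u * (v - t)).
have k0 : 0 < k by rewrite lt_min divr_gt0.
have kd : k < d.
  by rewrite (@le_lt_trans _ _ (d / 2)) ?ge_min ?lexx// ltr_pdivrMr//
    ltr_pMr// ltr1n.
have nuk : `|u * k| = k.
  have : `|u| ^+ 2 = 1 by rewrite -normrX expr2 uu normr1.
  by move=> /eqP; rewrite sqrp_eq1// normrM (gtr0_norm k0) => /eqP ->;
    rewrite mul1r.
have kv : k <= u * (v - t) by rewrite ge_min lexx orbT.
have uE : u = 1 \/ u = -1.
  have /eqP : (u - 1) * (u + 1) = 0 by rewrite -subr_sqr_1 expr2 uu subrr.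
  by rewrite mulf_eq0 subr_eq0 addr_eq0 => /orP[] /eqP; [left|right].
have wJ : t + u * k \in J.
  have iJ := @interval_is_interval _ J.
  case: uE kv => -> kv.
    by apply: (iJ t v) => //=; apply/andP; split; lra.
  by apply: (iJ v t) => //=; apply/andP; split; lra.
have uk0 : u * k != 0 by rewrite -normr_gt0 nuk.
have := Hd _ uk0; rewrite nuk => /(_ kd wJ); rewrite ler_norml => /andP[_ Hw].
exists (k / 2); first by rewrite divr_gt0.
move=> s sJ; rewrite ltr_norml => /andP[st1 st2].
(* The tangents at [s] (evaluated at [w]) and at [t] (evaluated at [s]), with the derivative
   estimate at [w], give [(f' s - f' t) (w - s) <= (e / 2) k], while [u (w - s) >= k / 2]. *)
have T1 := C1co_tangent sJ wJ; have T2 := C1co_tangent tJ sJ.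
have Y0 : k / 2 <= k - u * (s - t) by case: uE => ->; lra.
rewrite -(@ler_pM2r _ (k - u * (s - t)));
  last by rewrite (lt_le_trans _ Y0)// divr_gt0.
apply: (@le_trans _ _ (e / 2 * k)); last first.
  by rewrite -mulrA (mulrC 2^-1) ler_pM2l.
have -> : u * (f' s - f' t) * (k - u * (s - t)) =
   (f' s - f' t) * (u * k - u * (u * (s - t))) by ring.
rewrite u2; lra.
Qed.

(** [C1co] asks only for differentiability; convexity makes the derivative continuous, which gives a
    meaning to [f'] of an operator. *)
Lemma C1co_derive_continuous : {within [set` J], continuous f'}.
Proof.
apply/subspace_continuousP => t /= tJ; apply/cvgrPdist_le => e e0.
have [d1 d10 H1] := C1co_derive_usc tJ (mul1r 1) e0.
have [|d2 d20 H2] := @C1co_derive_usc _ (-1) tJ _ _ e0;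
  first by rewrite mulrNN mul1r.
have d0 : 0 < Num.min d1 d2 by rewrite lt_min d10.
rewrite near_withinE; near=> s => sJ.
have : `|s - t| < Num.min d1 d2.
  by rewrite distrC; near: s; exact: (nbhsx_ballx t _ d0).
rewrite lt_min => /andP[/(H1 s sJ) + /(H2 s sJ)].
rewrite mulN1r mul1r -[`|_|]/(`|f' t - f' s|) => ? ?; rewrite ler_norml;
  apply/andP; split; lra.
Unshelve. all: by end_near.
Qed.

End C1_convex.

(** * Self-adjoint operators *)

Section rdot.
Context {R : realType} {H : hilbertType R}.
Implicit Types (x y z : H) (c : R).

(** Inner products and norms take values in [R[i]]; [rdot] and [rnorm] bring estimates back to the
    ordered field [R]. For self-adjoint [T] nothing is lost in [<T x, x>], which is real. *)
Definition rdot x y : R := complex.Re (hdot x y).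

Definition rnorm x : R := complex.Re `|x|.

Lemma hdotDl x y z : hdot (x + y) z = hdot x z + hdot y z.
Proof. exact: linearDl. Qed.

Lemma hdotDr x y z : hdot x (y + z) = hdot x y + hdot x z.
Proof. exact: linearDr. Qed.

Lemma hdotZl (a : R[i]) x y : hdot (a *: x) y = a * hdot x y.
Proof. exact: linearZl_LR. Qed.

Lemma hdotZr (a : R[i]) x y : hdot x (a *: y) = Num.conj a * hdot x y.
Proof. exact: linearZr_LR. Qed.

Lemma hdot0l x : hdot 0 x = 0.
Proof. exact: linear0l. Qed.

Lemma hdot0r x : hdot x 0 = 0.
Proof. exact: linear0r. Qed.

Lemma hdotC x y : hdot y x = Num.conj (hdot x y).
Proof. by rewrite hermC /= expr0 mul1r. Qed.

Lemma rnormE x : `|x| = (rnorm x)%:C.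
Proof. by rewrite /rnorm RRe_real// normr_real. Qed.

Lemma rdotDl x y z : rdot (x + y) z = rdot x z + rdot y z.
Proof. by rewrite /rdot hdotDl raddfD. Qed.

Lemma rdotC x y : rdot x y = rdot y x.
Proof. by rewrite /rdot hdotC; case: (hdot _ _). Qed.

Lemma rdotZl c x y : rdot (c%:C *: x) y = c * rdot x y.
Proof.
by rewrite /rdot hdotZl; case: (hdot _ _) => a b /=; rewrite mul0r subr0.
Qed.

Lemma rdot0l x : rdot 0 x = 0.
Proof. by rewrite /rdot hdot0l. Qed.

Lemma rdotxx x : rdot x x = rnorm x ^+ 2.
Proof. by rewrite /rdot -hdot_norm rnormE -rmorphXn. Qed.

Lemma rdotDr x y z : rdot x (y + z) = rdot x y + rdot x z.
Proof. by rewrite rdotC rdotDl !(rdotC _ x). Qed.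

Lemma rdotZr c x y : rdot x (c%:C *: y) = c * rdot x y.
Proof. by rewrite rdotC rdotZl rdotC. Qed.

Lemma rdotNl x y : rdot (- x) y = - rdot x y.
Proof.
by rewrite -[- x]scaleN1r -(rmorphN1 (real_complex R)) rdotZl mulN1r.
Qed.

Lemma rdotNr x y : rdot x (- y) = - rdot x y.
Proof. by rewrite rdotC rdotNl rdotC. Qed.

Lemma rdotBl x y z : rdot (x - y) z = rdot x z - rdot y z.
Proof. by rewrite rdotDl rdotNl. Qed.

Lemma rdotBr x y z : rdot x (y - z) = rdot x y - rdot x z.
Proof. by rewrite rdotDr rdotNr. Qed.

Lemma rnorm_ge0 x : 0 <= rnorm x.
Proof. by rewrite -lecR -rnormE normr_ge0. Qed.

Lemma rnorm0 : rnorm 0 = 0.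
Proof. by rewrite /rnorm normr0. Qed.

Lemma rnorm_eq0 x : (rnorm x == 0) = (x == 0).
Proof. by rewrite -[RHS]normr_eq0 rnormE (inj_eq (@complexI R) _ 0). Qed.

Lemma rnorm_gt0 x : (0 < rnorm x) = (x != 0).
Proof. by rewrite lt_def rnorm_ge0 andbT rnorm_eq0. Qed.

Lemma rnormD x y : rnorm (x + y) <= rnorm x + rnorm y.
Proof. by rewrite -lecR rmorphD/= -!rnormE ler_normD. Qed.

Lemma rnormZ c x : rnorm (c%:C *: x) = `|c| * rnorm x.
Proof.
by apply: complexI; rewrite -rnormE normrZ rmorphM/= -rnormE normc_def /=
  expr0n addr0 sqrtr_sqr.
Qed.

Lemma rnormN x : rnorm (- x) = rnorm x.
Proof. by rewrite /rnorm normrN. Qed.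

Lemma rnormB x y : rnorm (x - y) <= rnorm x + rnorm y.
Proof. by rewrite -(rnormN y) rnormD. Qed.

Lemma rdistC x y : rnorm (x - y) = rnorm (y - x).
Proof. by rewrite -rnormN opprB. Qed.

End rdot.

(** * Positive operators and Cauchy-Schwarz inequalities *)

Section operators.
Context {R : realType} {H : hilbertType R}.
Implicit Types (S T : 'B(H)) (x y : H) (c : R).

Lemma bopE :
  (forall S T x, (S + T) x = S x + T x) * (forall S T x, (S * T) x = S (T x)) *
  (forall S x, (- S) x = - S x) *
  (forall (a : R[i]) S x, (a *: S) x = a *: S x) *
  (forall x, (1 : 'B(H)) x = x) * (forall x, (0 : 'B(H)) x = 0).
Proof. by do ![split]. Qed.

Lemma bopD T x y : T (x + y) = T x + T y.
Proof. exact: linearD. Qed.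

Lemma bopZ T (a : R[i]) x : T (a *: x) = a *: T x.
Proof. exact: linearZ. Qed.

Lemma bopB T x y : T (x - y) = T x - T y.
Proof. exact: linearB. Qed.

Lemma bop_rbounded T :
  exists2 M : R, 0 < M & forall x, rnorm (T x) <= M * rnorm x.
Proof.
have [M [M0 HM]] := bop_bounded T; exists (M + 1); first by rewrite ltr_wpDl.
move=> x; rewrite -lecR rmorphM/= -!rnormE (le_trans (HM x))//.
by rewrite ler_wpM2r// lecR lerDl.
Qed.

Lemma selfadjoint_rdot T : selfadjoint T ->
  forall x y, rdot (T x) y = rdot x (T y).
Proof. by move=> sT x y; rewrite /rdot sT. Qed.

Lemma selfadjoint_hdotE T : selfadjoint T ->
  forall x, hdot (T x) x = (rdot (T x) x)%:C.
Proof.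
move=> sT x; rewrite /rdot; have : hdot (T x) x = Num.conj (hdot (T x) x).
  by rewrite -hdotC sT.
by case: (hdot _ _) => a b [] /eqP;
  rewrite -addr_eq0 -mulr2n mulrn_eq0 => /eqP ->.
Qed.

Lemma selfadjoint_posop T : selfadjoint T ->
  posop T <-> forall x, 0 <= rdot (T x) x.
Proof.
by move=> sT; split=> + x => /(_ x); rewrite selfadjoint_hdotE// lecR.
Qed.

Lemma selfadjoint1 : selfadjoint (1 : 'B(H)).
Proof. by []. Qed.

Lemma selfadjointD S T : selfadjoint S -> selfadjoint T -> selfadjoint (S + T).
Proof. by move=> sS sT x y; rewrite !bopE hdotDl hdotDr sS sT. Qed.

Lemma selfadjointZ c T : selfadjoint T -> selfadjoint (c%:C *: T).
Proof.
move=> sT x y; rewrite !bopE hdotZl hdotZr sT; congr (_ * _).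
by rewrite /Num.conj/= oppr0.
Qed.

Lemma selfadjointN T : selfadjoint T -> selfadjoint (- T).
Proof.
move=> sT; rewrite -scaleN1r -(rmorphN1 (real_complex R)).
exact: selfadjointZ.
Qed.

Lemma selfadjointB S T : selfadjoint S -> selfadjoint T -> selfadjoint (S - T).
Proof. by move=> sS sT; apply: selfadjointD => //; apply: selfadjointN. Qed.

Lemma selfadjoint_sum (I : Type) (r : seq I) (F : I -> 'B(H)) :
  (forall i, selfadjoint (F i)) -> selfadjoint (\sum_(i <- r) F i).
Proof.
move=> sF; apply: (big_ind (@selfadjoint R H)) => //; last exact: selfadjointD.
by move=> x y; rewrite !bopE hdot0l hdot0r.
Qed.

Lemma selfadjointX T n : selfadjoint T -> selfadjoint (T ^+ n).
Proof.
move=> sT; elim: n => [|n IHn]; first exact: selfadjoint1.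
by move=> x y; rewrite {1}exprS exprSr !bopE sT IHn.
Qed.

(** Polarization: [<T z, z>] is real at [z = x + y] and at [z = i x + y], which compares the
    imaginary and the real parts of [<T x, y>] and [<T y, x>]. *)
Lemma posop_selfadjoint T : posop T -> selfadjoint T.
Proof.
move=> pT x y; rewrite [RHS]hdotC.
have im0 z : complex.Im (hdot (T z) z) = 0.
  by have := pT z; case: (hdot _ _) => a b; rewrite lecE /= => /andP[/eqP].
have := im0 (x + y); have := im0 (('i%C : R[i]) *: x + y).
rewrite !(bopD, bopZ, hdotDl, hdotDr, hdotZl, hdotZr).
have := im0 x; have := im0 y.
case: (hdot (T x) x) (hdot (T y) y) => [a b] [c d].
case: (hdot (T x) y) (hdot (T y) x) => [e g] [k l] /=.
move=> -> -> H1 H2; apply/eqP; rewrite eq_complex /=; apply/andP; split;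
  apply/eqP.
  by move: H1; lra.
by move: H2; lra.
Qed.

Lemma posop_rdot T : posop T -> forall x, 0 <= rdot (T x) x.
Proof. by move=> pT; apply/(selfadjoint_posop (posop_selfadjoint pT)). Qed.

Lemma rdot_posop_CS T x y : posop T ->
  (rdot (T x) y) ^+ 2 <= rdot (T x) x * rdot (T y) y.
Proof.
move=> pT; have sT := selfadjoint_rdot (posop_selfadjoint pT).
have pos := posop_rdot pT.
set b := rdot (T x) y; set a := rdot _ x; set c := rdot _ y.
have quad (r s : R) : 0 <= r ^+ 2 * a + r * s * b *+ 2 + s ^+ 2 * c.
  have := pos (r%:C *: x + s%:C *: y).
  rewrite !(bopD, bopZ, rdotDl, rdotDr, rdotZl, rdotZr) -/a -/b -/c.
  by rewrite (sT y) (rdotC y) -/b mulr2n; lra.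
have a0 : 0 <= a := pos x; have c0 : 0 <= c := pos y.
(* If [c = 0] and [b] is nonzero, the form is affine in [s], and the chosen [s] gives it the value
   [-1]. *)
have [c00|cn0] := eqVneq c 0.
  rewrite c00 mulr0; have [->|b0] := eqVneq b 0; first by rewrite expr0n.
  have b20 : 0 < b ^+ 2 by rewrite exprn_even_gt0.
  have := quad 1 (- (a + 1) / b / 2); rewrite c00 mulr0 addr0 expr1n !mul1r.
  rewrite (_ : - (a + 1) / b / 2 * b *+ 2 = - (a + 1));
    last by rewrite mulr2n; field.
  lra.
have {cn0}c0 : 0 < c by rewrite lt_def cn0.
(* With [r = c] and [s = - b] the form equals [c (a c - b^2)]. *)
have := quad c (- b); rewrite (_ : _ + _ = c * (a * c - b ^+ 2));
  last by rewrite mulr2n; ring.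
by rewrite pmulr_rge0// subr_ge0.
Qed.

Lemma posop1 : posop (1 : 'B(H)).
Proof.
by apply/(selfadjoint_posop selfadjoint1) => x; rewrite bopE rdotxx sqr_ge0.
Qed.

Lemma rdot_CS x y : `|rdot x y| <= rnorm x * rnorm y.
Proof.
have := rdot_posop_CS x y posop1; rewrite !bopE !rdotxx -exprMn.
by rewrite -[leLHS]real_normK ?num_real//
  ler_pXn2r ?nnegrE ?mulr_ge0 ?rnorm_ge0.
Qed.

(** Cauchy-Schwarz for the form of [T], taken at [x] and [T x], bounds [|T x|^4] by
    [<T x, x> M |T x|^2]. *)
Lemma posop_sqr_rnorm T (M : R) : posop T ->
  (forall x, rdot (T x) x <= M * rnorm x ^+ 2) ->
  forall x, rnorm (T x) ^+ 2 <= M * rdot (T x) x.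
Proof.
move=> pT HM x; have [Tx0|Tx0] := eqVneq (T x) 0.
  by rewrite Tx0 rnorm0 expr0n rdot0l mulr0.
have nTx : 0 < rnorm (T x) ^+ 2 by rewrite exprn_gt0// rnorm_gt0.
rewrite -(ler_pM2r nTx).
have := rdot_posop_CS x (T x) pT; rewrite rdotxx expr2 => /le_trans; apply.
by rewrite -mulrA mulrCA ler_wpM2l// (posop_rdot pT).
Qed.

Lemma posop_rnorm T (M : R) : 0 <= M -> posop T ->
  (forall x, rdot (T x) x <= M * rnorm x ^+ 2) ->
  forall x, rnorm (T x) <= M * rnorm x.
Proof.
move=> M0 pT HM x; have := posop_sqr_rnorm pT HM x.
move=> /le_trans/(_ (ler_wpM2l M0 (HM x))); rewrite mulrA -expr2 -exprMn.
by rewrite ler_pXn2r ?nnegrE ?mulr_ge0 ?rnorm_ge0.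
Qed.

Lemma rdot_bounded T :
  exists2 M : R, 0 < M & forall x, `|rdot (T x) x| <= M * rnorm x ^+ 2.
Proof.
have [M M0 HM] := bop_rbounded T; exists M => // x.
by rewrite (le_trans (rdot_CS _ _))// expr2 mulrA ler_wpM2r ?rnorm_ge0.
Qed.

(** * Completeness, Neumann series and invertibility *)

(** The limit is taken pointwise, and the estimate passes to it as [n] grows; keeping the rate [e]
    in the conclusion gives convergence in operator norm. *)
Lemma bop_cauchy_cvg (T : nat -> 'B(H)) (e : nat -> R) :
  e @ \oo --> (0 : R) ->
  (forall m n x, (m <= n)%N -> rnorm (T m x - T n x) <= e m * rnorm x) ->
  exists S : 'B(H), forall n x, rnorm (T n x - S x) <= e n * rnorm x.
Proof.
move=> e0 HT.
have cT x : cvgn (T ^~ x).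
  apply: cauchy_cvg.
  apply/cauchy_exP => eps eps0.
  (* Radii in [H] are elements of [R[i]]; a positive one is real. *)
  have epsE : eps = (complex.Re eps)%:C by rewrite RRe_real// gtr0_real.
  have : 0 < complex.Re eps by rewrite -ltcR -epsE.
  move: (complex.Re eps) epsE => d -> d0.
  have [|n _ en] := cvgr_lt 0 e0 (d / (rnorm x + 1)).
    by rewrite divr_gt0// ltr_wpDl// rnorm_ge0.
  exists (T n x); exists n => // m /= nm; rewrite -ball_normE/= rnormE ltcR.
  rewrite (le_lt_trans (HT _ _ _ nm))//.
  have /= := en n (leqnn n); rewrite ltr_pdivlMr ?ltr_wpDl ?rnorm_ge0//.
  have [e_ge0|e_lt0] := leP 0 (e n); last first.
    by move=> _; rewrite (le_lt_trans _ d0)// mulr_le0_ge0 ?rnorm_ge0 ?ltW.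
  by apply: le_lt_trans; rewrite ler_wpM2l// lerDl.
pose S x : H := lim (T n x @[n --> \oo]).
have HS n x : rnorm (T n x - S x) <= e n * rnorm x.
  apply/ler_addgt0Pr => d d0.
  have /cvgrPdist_lt/(_ d%:C) : T m x @[m --> \oo] --> S x := cT x.
  rewrite ltcR => /(_ d0)[N _ HN]; have /= := HN (maxn N n) (leq_maxl _ _).
  rewrite rnormE ltcR => /ltW Hd.
  rewrite -(subrK (T (maxn N n) x) (T n x)) -addrA.
  rewrite (le_trans (rnormD _ _))// lerD//.
    exact/HT/leq_maxr.
  by rewrite rdistC.
have lS : linear S.
  move=> a x y; apply: (@norm_cvg_unique _ _ (T n (a *: x + y) @[n --> \oo])).
    exact: cT.
  rewrite /=; under eq_cvg do rewrite bopD bopZ.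
  by apply: cvgD; [apply: cvgZl_tmp|]; exact: cT.
have bS : exists M : R, forall x, `|S x| <= M%:C * `|x|.
  have [M M0 HM] := bop_rbounded (T 0%N); exists (e 0%N + M) => x.
  rewrite !rnormE -rmorphM lecR -(subrK (T 0%N x) (S x)).
  by rewrite (le_trans (rnormD _ _))// mulrDl lerD// rdistC.
by exists (Bop (bopP lS bS)).
Qed.

Lemma bopZMl (a : R[i]) S T : (a *: S) * T = a *: (S * T).
Proof. by apply: bop_eq. Qed.

Lemma bopZMr (a : R[i]) S T : S * (a *: T) = a *: (S * T).
Proof. by apply: bop_eq => x; rewrite !bopE bopZ. Qed.

Lemma invertible_opZ (a : R[i]) T : a != 0 -> invertible_op T ->
  invertible_op (a *: T).
Proof.
move=> a0 [S [ST TS]]; exists (a^-1 *: S); split.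
  by rewrite bopZMl bopZMr scalerA mulVf// scale1r.
by rewrite bopZMl bopZMr scalerA mulfV// scale1r.
Qed.

Lemma invertible_opM S T : invertible_op S -> invertible_op T ->
  invertible_op (S * T).
Proof.
move=> [S' [SS' S'S]] [T' [TT' T'T]]; exists (T' * S'); split.
  by rewrite mulrA -(mulrA T') SS' mulr1.
by rewrite mulrA -(mulrA S) T'T mulr1.
Qed.

(** The inverse is the sum of the powers of [T]. The tail of the geometric series,
    [e n = r^n / (1 - r)], bounds the distance to the [n]-th partial sum. *)
Lemma neumann T (r : R) : 0 <= r -> r < 1 ->
  (forall x, rnorm (T x) <= r * rnorm x) ->
  invertible_op (1 - T).
Proof.
move=> r0 r1 HT; have r1' : 0 < 1 - r by rewrite subr_gt0.
have HTn n x : rnorm ((T ^+ n) x) <= r ^+ n * rnorm x.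
  elim: n => [|n IHn]; first by rewrite mul1r.
  by rewrite !exprS bopE (le_trans (HT _))// -mulrA ler_wpM2l.
pose U n : 'B(H) := \sum_(k < n) T ^+ k; pose e n := r ^+ n / (1 - r).
have US n : U n.+1 = U n + T ^+ n by rewrite /U big_ord_recr.
have HU m n x : (m <= n)%N -> rnorm (U m x - U n x) <= (e m - e n) * rnorm x.
  elim: n => [|n IHn].
    by rewrite leqn0 => /eqP ->; rewrite !subrr mul0r rnorm0.
  rewrite leq_eqVlt => /predU1P[->|]; first by rewrite !subrr mul0r rnorm0.
  rewrite ltnS => /IHn Hmn; rewrite US bopE opprD addrA.
  rewrite (le_trans (rnormB _ _))// (_ : e m - e n.+1 = (e m - e n) + r ^+ n).
    by rewrite mulrDl lerD.
  by rewrite /e exprS; field; rewrite gt_eqF.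
have e0 n : 0 <= e n by rewrite divr_ge0 ?exprn_ge0// ltW.
have rn0 : r ^+ n @[n --> \oo] --> (0 : R).
  by apply: cvg_expr; rewrite ger0_norm.
have ecvg : e @ \oo --> (0 : R).
  rewrite -(mul0r (1 - r)^-1).
  by apply: cvgM; [exact: rn0|exact: cvg_cst].
have [|V HV] := bop_cauchy_cvg ecvg (T := U).
  move=> m n x mn; rewrite (le_trans (HU _ _ _ mn))// ler_wpM2r ?rnorm_ge0//.
  by rewrite gerBl.
have UE n : (1 - T) * U n = 1 - T ^+ n.
  elim: n => [|n IHn]; first by rewrite /U big_ord0 mulr0 subrr.
  rewrite US mulrDr IHn mulrBl mul1r exprS.
  by rewrite addrA subrK.
have UE' n : U n * (1 - T) = 1 - T ^+ n.
  elim: n => [|n IHn]; first by rewrite /U big_ord0 mul0r subrr.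
  rewrite US mulrDl IHn mulrBr mulr1 exprSr.
  by rewrite addrA subrK.
(* Both inverse identities hold for [U n] up to [T ^+ n]; replacing [U n] by [V] costs a multiple of
   [e n], so the total error tends to 0. *)
have lim0 x y (c : R) : 0 <= c ->
  (forall n, rnorm (x - y) <= c * (e n + r ^+ n)) -> x = y.
  move=> c0 Hxy; apply/eqP; rewrite -subr_eq0 -rnorm_eq0 eq_le rnorm_ge0 andbT.
  have c1 : c * (e n + r ^+ n) @[n --> \oo] --> c * (0 + 0 : R).
    by apply: cvgM; [exact: cvg_cst|exact: cvgD].
  rewrite (_ : 0 = c * (0 + 0)); last by rewrite addr0 mulr0.
  rewrite -(cvg_lim _ c1)//; apply: limr_ge; first exact: cvgP c1.
  exact: nearW.
exists V; split; apply: bop_eq => x; rewrite !bopE.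
  set w := x - T x; apply: (lim0 _ _ (rnorm w + rnorm x)).
    by rewrite addr_ge0 ?rnorm_ge0.
  move=> n; have -> : V w - x = (V w - U n w) - (T ^+ n) x.
    have : (U n * (1 - T)) x = (1 - T ^+ n) x by rewrite UE'.
    rewrite !bopE -/w => ->.
    by rewrite opprB addrA addrAC addrK.
  rewrite (le_trans (rnormB _ _))// mulrDl lerD//.
    rewrite rdistC (le_trans (HV _ _))// mulrC ler_wpM2l ?rnorm_ge0//.
    by rewrite lerDl exprn_ge0.
  by rewrite (le_trans (HTn _ _))// mulrC ler_wpM2l ?rnorm_ge0// lerDr.
apply: (lim0 _ _ (2 * rnorm x)); first by rewrite mulr_ge0 ?rnorm_ge0.
move=> n; have -> : V x - T (V x) - x = (1 - T) (V x - U n x) - (T ^+ n) x.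
  have : ((1 - T) * U n) x = (1 - T ^+ n) x by rewrite UE.
  rewrite bopB !bopE => ->.
  by rewrite opprB addrA addrAC addrK.
rewrite (le_trans (rnormB _ _))// [leRHS]mulrDr lerD//.
  rewrite !bopE (le_trans (rnormB _ _))// -mulrA mulr_natl mulr2n.
  have Vn : rnorm (V x - U n x) <= rnorm x * e n by rewrite rdistC mulrC.
  by rewrite lerD// (le_trans (HT _))// (le_trans _ Vn)//
    ler_piMl ?rnorm_ge0 ?ltW.
rewrite (le_trans (HTn _ _))// mulrC ler_wpM2r ?exprn_ge0//.
by rewrite ler_peMl ?rnorm_ge0// ler1n.
Qed.

(** Put [P = 1 - T / N]. Then [0 <= P <= 1 - c / N], so [P] has norm less than 1 and [T / N = 1 - P]
    is invertible by the Neumann series. *)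
Lemma coercive_invertible T (c : R) : selfadjoint T -> 0 < c ->
  (forall x, c * rnorm x ^+ 2 <= rdot (T x) x) -> invertible_op T.
Proof.
move=> sT c0 HT; have [M M0 HM] := rdot_bounded T.
(* [N >= M] makes [P] positive, and [N > c] makes [1 - c / N] positive. *)
pose N := M + c; have N0 : 0 < N by rewrite addr_gt0.
pose P : 'B(H) := 1 - N^-1%:C *: T.
have sP : selfadjoint P by apply: selfadjointB => //; exact: selfadjointZ.
have PE x : rdot (P x) x = rnorm x ^+ 2 - N^-1 * rdot (T x) x.
  by rewrite !bopE rdotBl rdotZl rdotxx.
have pP : posop P.
  apply/selfadjoint_posop => // x; rewrite PE subr_ge0 mulrC ler_pdivrMr//.
  rewrite (le_trans (ler_norm _))// (le_trans (HM x))// mulrC.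
  by rewrite ler_wpM2l ?sqr_ge0// lerDl ltW.
have cN : c / N < 1 by rewrite ltr_pdivrMr// mul1r ltr_pwDl.
have cN0 : 0 < c / N by rewrite divr_gt0.
have r0 : 0 <= 1 - c / N by rewrite subr_ge0 ltW.
have r1 : 1 - c / N < 1 by rewrite gtrBl.
have HP : forall x, rnorm (P x) <= (1 - c / N) * rnorm x.
  apply: posop_rnorm => // x; rewrite PE mulrBl mul1r lerB// (mulrC c) -mulrA.
  by rewrite ler_pM2l ?invr_gt0.
have := neumann r0 r1 HP; rewrite /P subKr.
have NC0 : N%:C != 0 by rewrite (inj_eq (@complexI R) _ 0) gt_eqF.
move=> /(invertible_opZ NC0).
by rewrite scalerA -rmorphM/= mulfV ?gt_eqF// scale1r.
Qed.

(** * Spectrum and numerical range *)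

(** [m] is the infimum of [<T x, x>] over unit vectors. If [Q = T - m], which is positive, had an
    inverse [V], then [1 = |V Q x|^2 <= N^2 L <Q x, x>] would keep [<T x, x>] above [m + d] with a
    fixed [d > 0]. A nonzero space is required: on the zero space the spectrum is empty. *)
Lemma selfadjoint_inf_spectrum T : selfadjoint T -> (exists x : H, x != 0) ->
  exists2 m : R, spectrum T m%:C & forall x, m * rnorm x ^+ 2 <= rdot (T x) x.
Proof.
move=> sT [x0 x00]; have [M M0 HM] := rdot_bounded T.
pose E := [set rdot (T x) x | x in [set x : H | rnorm x = 1]].
have normed x : x != 0 -> rnorm ((rnorm x)^-1%:C *: x) = 1.
  move=> xn0; rewrite rnormZ ger0_norm ?invr_ge0 ?rnorm_ge0// mulVf//.
  by rewrite gt_eqF// rnorm_gt0.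
have E0 : E !=set0.
  pose u := (rnorm x0)^-1%:C *: x0.
  by exists (rdot (T u) u), u => //; exact: normed.
have lbE : has_lbound E.
  exists (- M) => _ [x /= nx <-]; have := HM x;
    rewrite nx expr1n mulr1 ler_norml.
  by case/andP.
have HE x : rnorm x = 1 -> inf E <= rdot (T x) x.
  by move=> nx; apply: ge_inf => //; exists x.
have Hinf x : inf E * rnorm x ^+ 2 <= rdot (T x) x.
  have [->|xn0] := eqVneq x 0;
    first by rewrite rnorm0 expr0n mulr0 rdotC rdot0l.
  have := HE _ (normed x xn0); rewrite bopZ rdotZl rdotZr mulrA -expr2.
  rewrite exprVn mulrC ler_pdivlMr// exprn_gt0// rnorm_gt0//.
exists (inf E) => //= -[V [VT _]].
set Q := T - _ in VT.
have sQ : selfadjoint Q by apply: selfadjointB => //; exact: selfadjointZ.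
have QE x : rdot (Q x) x = rdot (T x) x - inf E * rnorm x ^+ 2.
  by rewrite !bopE rdotBl rdotZl rdotxx.
have pQ : posop Q by apply/selfadjoint_posop => // x; rewrite QE subr_ge0.
have [N N0 HN] := bop_rbounded V; have [L L0 HL] := rdot_bounded Q.
have HQ x : rnorm (Q x) ^+ 2 <= L * rdot (Q x) x.
  by apply: posop_sqr_rnorm => // y; rewrite (le_trans (ler_norm _)).
pose d := (N ^+ 2 * L)^-1.
have d0 : 0 < d by rewrite invr_gt0 mulr_gt0// exprn_gt0.
have : inf E + d <= inf E.
  apply: lb_le_inf => // _ [x /= nx <-].
  have := QE x; rewrite nx expr1n mulr1 => /eqP;
    rewrite eq_sym subr_eq => /eqP ->.
  rewrite addrC lerD2r /d -[_^-1]mul1r ler_pdivrMr ?mulr_gt0 ?exprn_gt0//.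
  have -> : 1 = rnorm (V (Q x)) ^+ 2.
    have : (V * Q) x = (1 : 'B(H)) x by rewrite VT.
    by rewrite !bopE => ->; rewrite nx expr1n.
  rewrite mulrC -mulrA; apply: (@le_trans _ _ (N ^+ 2 * rnorm (Q x) ^+ 2)).
    by rewrite -exprMn lerXn2r ?nnegrE ?mulr_ge0 ?rnorm_ge0 ?(ltW N0).
  by rewrite ler_wpM2l// sqr_ge0.
by rewrite gerDl leNgt d0.
Qed.

Lemma selfadjoint_sup_spectrum T : selfadjoint T -> (exists x : H, x != 0) ->
  exists2 m : R, spectrum T m%:C & forall x, rdot (T x) x <= m * rnorm x ^+ 2.
Proof.
move=> sT H0; have [m sm Hm] := selfadjoint_inf_spectrum (selfadjointN sT) H0.
exists (- m) => [[S [ST TS]]|x]; last first.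
  by have := Hm x; rewrite bopE rdotNl mulNr lerNr.
apply: sm; exists (- S).
have E : - T - m%:C *: (1 : 'B(H)) = - (T - (- m)%:C *: (1 : 'B(H))).
  by rewrite rmorphN scaleNr opprK opprD.
by rewrite E !mulrNN.
Qed.

(** For [t < m] the operator [T - t] is coercive with constant [m - t]. *)
Lemma spectrum_ge T (m t : R) : selfadjoint T ->
  (forall x, m * rnorm x ^+ 2 <= rdot (T x) x) -> spectrum T t%:C -> m <= t.
Proof.
move=> sT Hm; apply: contra_notT; rewrite -ltNge => tm.
apply: (@coercive_invertible _ (m - t)); last 2 first.
- by rewrite subr_gt0.
- by move=> x; rewrite !bopE rdotBl rdotZl rdotxx mulrBl lerB.
by apply: selfadjointB => //; exact: selfadjointZ.
Qed.

Lemma spectrum_le T (m t : R) : selfadjoint T ->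
  (forall x, rdot (T x) x <= m * rnorm x ^+ 2) -> spectrum T t%:C -> t <= m.
Proof.
move=> sT Hm; apply: contra_notT; rewrite -ltNge => mt.
have N10 : (-1 : R[i]) != 0 by rewrite oppr_eq0 oner_eq0.
have -> : T - t%:C *: (1 : 'B(H)) = -1 *: (t%:C *: (1 : 'B(H)) - T).
  by rewrite scaleN1r opprB.
apply: (invertible_opZ N10); apply: (@coercive_invertible _ (t - m)).
- by apply: selfadjointB => //; exact: selfadjointZ.
- by rewrite subr_gt0.
- by move=> x; rewrite !bopE rdotBl rdotZl rdotxx mulrBl lerB.
Qed.

(* For [l = a + i b] with [b != 0], [(T - l) (T - l^* ) = (T - a) ^+ 2 + b ^+ 2]
   is coercive. *)
Lemma selfadjoint_spectrum_real T (l : R[i]) : selfadjoint T -> spectrum T l ->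
  l = (complex.Re l)%:C.
Proof.
move=> sT; case: l => a b /=; have [->//|b0] := eqVneq b 0; case.
(* [U W c] is [W - i c]. With [S = T - a], the operator to invert is [U S b], and [U S (- b)] is its
   companion factor. *)
pose U (W : 'B(H)) (c : R) := W - (0 +i* c) *: (1 : 'B(H)).
have UE W c : U W c * U W (- c) = W * W + (c ^+ 2)%:C *: (1 : 'B(H)).
  rewrite /U mulrDl !mulrDr !mulrN !mulNr !(bopZMl, bopZMr, mulr1, mul1r).
  rewrite opprK scalerA.
  have -> : (0 +i* c) * (0 +i* - c) = (c ^+ 2)%:C.
    by apply/eqP; rewrite eq_complex /=; apply/andP; split; apply/eqP; ring.
  have -> : (0 +i* - c) = - (0 +i* c).
    by apply/eqP; rewrite eq_complex /= oppr0 !eqxx.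
  by rewrite scaleNr opprK addrA addrK.
pose S : 'B(H) := T - a%:C *: (1 : 'B(H)).
have sS : selfadjoint S by apply: selfadjointB => //; exact: selfadjointZ.
have -> : T - (a +i* b) *: (1 : 'B(H)) = U S b.
  rewrite /U /S -addrA -opprD -scalerDl; congr (_ - _ *: _).
  by apply/eqP; rewrite eq_complex /= addr0 add0r !eqxx.
have [V [VQ QV]] : invertible_op (S * S + (b ^+ 2)%:C *: (1 : 'B(H))).
  apply: (@coercive_invertible _ (b ^+ 2)); last 2 first.
  - by rewrite exprn_even_gt0.
  - move=> x; rewrite !bopE rdotDl rdotZl rdotxx lerDr (selfadjoint_rdot sS).
    by rewrite rdotxx sqr_ge0.
  apply: selfadjointD; last exact: selfadjointZ.
  by move=> x y; rewrite !bopE !sS.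
have UE' : U S (- b) * U S b = S * S + (b ^+ 2)%:C *: (1 : 'B(H)).
  by have := UE S (- b); rewrite opprK sqrrN.
exists (V * U S (- b)); split; first by rewrite -mulrA UE'.
(* Both products of [U S b] and [U S (- b)] equal the same operator with inverse [V], so [V]
   commutes with [U S (- b)] and the one-sided inverses agree. *)
have <- : U S (- b) * V = V * U S (- b); last by rewrite mulrA UE.
by rewrite -[LHS]mul1r -VQ -[X in V * X]UE' -!mulrA (mulrA (U S b)) UE QV mulr1.
Qed.

(** * Polynomials in an operator *)

(** Complex coefficients are allowed so that polynomials split into linear factors; [poly_opE]
    transfers the results to real ones. *)
Definition cpoly_op T (q : {poly R[i]}) : 'B(H) :=
  \sum_(i < size q) q`_i *: T ^+ i.

Lemma cpoly_opE T (q : {poly R[i]}) n : (size q <= n)%N ->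
  cpoly_op T q = \sum_(i < n) q`_i *: T ^+ i.
Proof.
move=> qn; rewrite /cpoly_op (big_ord_widen n (fun i => q`_i *: T ^+ i))//
  big_mkcond/=.
apply: eq_bigr => i _; case: ltnP => // ni.
by rewrite nth_default// scale0r.
Qed.

Lemma cpoly_opD T (p q : {poly R[i]}) :
  cpoly_op T (p + q) = cpoly_op T p + cpoly_op T q.
Proof.
pose n := maxn (size p) (size q).
rewrite !(@cpoly_opE _ _ n) ?leq_maxl ?leq_maxr//; last exact: size_polyD.
by rewrite -big_split; apply: eq_bigr => i _; rewrite coefD scalerDl.
Qed.

Lemma cpoly_opZ T a p : cpoly_op T (a *: p) = a *: cpoly_op T p.
Proof.
rewrite !(@cpoly_opE _ _ (size p)) ?size_scale_leq// scaler_sumr.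
by apply: eq_bigr => i _; rewrite coefZ scalerA.
Qed.

Lemma cpoly_opMX T p : cpoly_op T (p * 'X) = cpoly_op T p * T.
Proof.
rewrite (@cpoly_opE _ _ (size p).+1) ?size_polyMleq//; last first.
  by rewrite (leq_trans (size_polyMleq _ _))// size_polyX addn2.
rewrite big_ord_recl coefMX/= scale0r add0r mulr_suml.
by apply: eq_bigr => i _; rewrite coefMX/= bopZMl -exprSr.
Qed.

Lemma cpoly_opC T a : cpoly_op T a%:P = a *: (1 : 'B(H)).
Proof.
rewrite (@cpoly_opE _ _ 1) ?size_polyC_leq1// big_ord1 coefC.
by [].
Qed.

Lemma cpoly_opX T : cpoly_op T 'X = T.
Proof. by rewrite -['X]mul1r cpoly_opMX -polyC1 cpoly_opC scale1r mul1r. Qed.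

Lemma cpoly_opM T p q : cpoly_op T (p * q) = cpoly_op T p * cpoly_op T q.
Proof.
elim/poly_ind: q => [|q c IHq].
  by rewrite mulr0 -[0]/(0%:P) cpoly_opC scale0r mulr0.
rewrite mulrDr mulrA cpoly_opD cpoly_opMX IHq cpoly_opD cpoly_opMX cpoly_opC.
by rewrite [p * _]mulrC mul_polyC cpoly_opZ mulrDr bopZMr mulr1 mulrA.
Qed.

(** Linear factors are split off one at a time: if [T - z] were invertible for every root [z], then
    [q(T)] would be a product of invertible operators. *)
Lemma cpoly_op_spectrum T (q : {poly R[i]}) : q != 0 ->
  ~ invertible_op (cpoly_op T q) ->
  exists2 z, root q z & spectrum T z.
Proof.
have [n] := ubnP (size q); elim: n q => // n IHn q qn q0 Tq.
have [/eqP/size_poly1P[c c0 qE]|q1] := eqVneq (size q) 1%N.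
  case: Tq; rewrite qE cpoly_opC; apply: invertible_opZ => //.
  by exists 1; rewrite !mulr1.
have [z qz] := closed_rootP q q1; have /factor_theorem[r qE] := qz.
have r0 : r != 0 by apply: contraNneq q0 => r0; rewrite qE r0 mul0r.
have [Tz|/contrapT Tz] := pselect (spectrum T z); first by exists z.
have [||y ry Ty] := IHn r _ r0.
- move: qn; rewrite qE size_Mmonic ?monicXsubC// size_XsubC addn2/= ltnS.
  by [].
- apply: contra_not Tq => Tr; rewrite qE cpoly_opM; apply: invertible_opM => //.
  by rewrite cpoly_opD cpoly_opX -polyCN cpoly_opC scaleNr.
by exists y => //; rewrite qE rootM ry.
Qed.

Lemma poly_opE T (p : {poly R}) :
  poly_op T p = cpoly_op T (map_poly (real_complex R) p).
Proof.
rewrite /poly_op (@cpoly_opE _ _ (size p)) ?size_map_poly//.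
by apply: eq_bigr => i _; rewrite coef_map.
Qed.

Lemma poly_opD T (p q : {poly R}) :
  poly_op T (p + q) = poly_op T p + poly_op T q.
Proof. by rewrite !poly_opE rmorphD cpoly_opD. Qed.

Lemma poly_opZ T (c : R) (p : {poly R}) :
  poly_op T (c *: p) = c%:C *: poly_op T p.
Proof. by rewrite !poly_opE map_polyZ cpoly_opZ. Qed.

Lemma poly_opC T (c : R) : poly_op T c%:P = c%:C *: (1 : 'B(H)).
Proof. by rewrite poly_opE map_polyC cpoly_opC. Qed.

Lemma poly_opM T (p q : {poly R}) :
  poly_op T (p * q) = poly_op T p * poly_op T q.
Proof. by rewrite !poly_opE rmorphM cpoly_opM. Qed.

Lemma poly_opX T : poly_op T 'X = T.
Proof. by rewrite poly_opE map_polyX cpoly_opX. Qed.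

Lemma poly_opB T (p q : {poly R}) :
  poly_op T (p - q) = poly_op T p - poly_op T q.
Proof. by rewrite poly_opD -scaleN1r poly_opZ rmorphN1 scaleN1r. Qed.

Lemma selfadjoint_poly_op T (p : {poly R}) : selfadjoint T ->
  selfadjoint (poly_op T p).
Proof.
by move=> sT; apply: selfadjoint_sum => i; apply/selfadjointZ/selfadjointX.
Qed.

Lemma posop_poly_op T (p : {poly R}) : selfadjoint T ->
  (forall t, spectrum T t%:C -> 0 <= p.[t]) -> posop (poly_op T p).
Proof.
move=> sT pT; have sp := selfadjoint_poly_op p sT.
apply/selfadjoint_posop => // x; have [->|x0] := eqVneq x 0;
  first by rewrite rdotC rdot0l.
have ex0 : exists x : H, x != 0 by exists x.
have [m mp Hm] := selfadjoint_inf_spectrum sp ex0.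
suff m0 : 0 <= m by rewrite (le_trans _ (Hm x))// mulr_ge0// sqr_ge0.
(* If [p] is the constant [m] there is no root to extract, and any point of the nonempty spectrum
   gives [0 <= m]. *)
have [pm0|pm0] := eqVneq p m%:P.
  by have [t Tt _] := selfadjoint_inf_spectrum sT ex0; have := pT t Tt;
    rewrite pm0 hornerC.
pose q := map_poly (real_complex R) (p - m%:P).
have q0 : q != 0 by rewrite map_poly_eq0 subr_eq0.
have [|z] := cpoly_op_spectrum q0 (T := T).
  by rewrite -poly_opE poly_opB poly_opC.
move=> + Tz; have zE := selfadjoint_spectrum_real sT Tz; rewrite zE in Tz *.
rewrite /q /root horner_map/= (inj_eq (@complexI R) _ 0) !hornerE subr_eq0 =>
  /eqP <-.
exact: pT.
Qed.

(** The polynomial [e^2 - p^2] is nonnegative on the spectrum, and [<p(T)^2 x, x> = |p(T) x|^2]. *)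
Lemma poly_op_bound T (p : {poly R}) (e : R) : selfadjoint T -> 0 <= e ->
  (forall t, spectrum T t%:C -> `|p.[t]| <= e) ->
  forall x, rnorm (poly_op T p x) <= e * rnorm x.
Proof.
move=> sT e0 Hp x; have sp := selfadjoint_poly_op p sT.
have /posop_rdot/(_ x) : posop (poly_op T ((e ^+ 2)%:P - p * p)).
  apply: posop_poly_op => // t /Hp; rewrite !hornerE subr_ge0 -expr2 => pe.
  by rewrite -[X in X <= _]real_normK ?num_real// lerXn2r ?nnegrE.
rewrite poly_opB poly_opC poly_opM !bopE rdotBl rdotZl (selfadjoint_rdot sp)
  !rdotxx.
by rewrite subr_ge0 -exprMn ler_pXn2r ?nnegrE ?mulr_ge0 ?rnorm_ge0.
Qed.

(** * Operator norm and continuous functional calculus *)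

Lemma opnorm_ge T x : rnorm (T x) <= opnorm T * rnorm x.
Proof.
have [M M0 HM] := bop_rbounded T.
have [->|x0] := eqVneq x 0; first by rewrite linear0 rnorm0 mulr0.
have nx : 0 < rnorm x by rewrite rnorm_gt0.
rewrite -ler_pdivrMr//; apply: ub_le_sup => /=.
  exists M => _ [y /= y1 <-]; apply: (le_trans (HM y)).
  by rewrite ler_piMr ?(ltW M0)// -lecR -rnormE.
exists ((rnorm x)^-1%:C *: x) => /=.
  rewrite rnormE rnormZ ger0_norm ?invr_ge0 ?rnorm_ge0// mulVf ?gt_eqF//.
rewrite -[complex.Re _]/(rnorm _) bopZ rnormZ ger0_norm ?invr_ge0 ?rnorm_ge0//.
by rewrite mulrC.
Qed.

Lemma opnorm_le T (M : R) : 0 <= M ->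
  (forall x, rnorm (T x) <= M * rnorm x) -> opnorm T <= M.
Proof.
move=> M0 HM; apply: ge_sup.
  by exists (complex.Re `|T 0|), 0 => //=; rewrite normr0 ler01.
move=> _ [x /= x1 <-]; apply: (le_trans (HM x)).
by rewrite ler_piMr// -lecR -rnormE.
Qed.

Lemma opnorm_ge0 T : 0 <= opnorm T.
Proof.
have [M M0 HM] := bop_rbounded T; apply: ub_le_sup => /=.
  exists M => _ [y /= y1 <-]; apply: (le_trans (HM y)).
  by rewrite ler_piMr ?(ltW M0)// -lecR -rnormE.
by exists 0; rewrite /= ?normr0 ?ler01// linear0 normr0.
Qed.

(* Satisfied by every limit that [cfc] may select, so that the uniqueness of the
   limit is never needed. *)
Definition cfc_approx T (g : R -> R) S : Prop := forall e : R, 0 < e ->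
  exists p : {poly R}, (forall t, spectrum T t%:C -> `|p.[t] - g t| <= e) /\
    forall x, rnorm (poly_op T p x - S x) <= e * rnorm x.

Lemma cfc_lim_approx T g S : cfc_lim T g S -> cfc_approx T g S.
Proof.
move=> [p [gp Sp]] e e0.
have Hg : \forall n \near \oo, forall t, spectrum T t%:C ->
  `|(p n).[t] - g t| <= e.
  have : nbhs (g : {uniform` [set t : R | spectrum T t%:C] -> R})
      [set h | forall t, spectrum T t%:C -> `|h t - g t| <= e].
    apply/uniform_nbhs; exists [set uv : R * R | ball uv.1 e uv.2]; split.
      exact: entourage_ball (PosNum e0).
    move=> h /= Hh t /Hh; rewrite /ball/= distrC; exact: ltW.
  exact: gp.
have HS : \forall n \near \oo, opnorm (poly_op T (p n) - S) < e.
  exact: cvgr_lt Sp _ e0.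
near \oo => n; exists (p n); split; first by near: n.
move=> x; have := opnorm_ge (poly_op T (p n) - S) x;
  rewrite !bopE => /le_trans; apply.
by rewrite ler_wpM2r ?rnorm_ge0// ltW//; near: n.
Unshelve. all: by end_near.
Qed.

(** Weierstrass polynomials within [1 / (n + 1)] of [g] differ on the spectrum by at most
    [2 / (m + 1)] for indices from [m] on, so [poly_op_bound] makes their values at [T] a Cauchy
    sequence. *)
Lemma cfc_lim_exists T g (a b : R) : selfadjoint T ->
  (forall t, spectrum T t%:C -> a <= t <= b) ->
    {within `[a, b], continuous g} ->
  exists S, cfc_lim T g S.
Proof.
move=> sT sab cg.
have /choice[p Hp] : forall n, exists p : {poly R},
    forall t, a <= t <= b -> `|p.[t] - g t| <= n.+1%:R^-1.
  by move=> n; apply: weierstrass; rewrite ?invr_gt0.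
have d0 : n.+1%:R^-1 *+ 2 @[n --> \oo] --> (0 : R).
  by rewrite -[0](mul0rn _ 2); apply: cvgMn; exact: cvg_harmonic.
have [|S HS] := bop_cauchy_cvg d0 (T := fun n => poly_op T (p n)).
  move=> m n x mn.
  have := @poly_op_bound T (p m - p n) (m.+1%:R^-1 *+ 2) sT _ _ x.
  rewrite poly_opB !bopE; apply; first by rewrite mulrn_wge0.
  move=> t /sab tab; rewrite !hornerE.
  rewrite (_ : _ - _ = ((p m).[t] - g t) - ((p n).[t] - g t)); last by ring.
  rewrite (le_trans (ler_normB _ _))// mulr2n lerD// ?Hp//.
  by rewrite (le_trans (Hp n t tab))// lef_pV2 ?posrE// ler_nat.
exists S; exists p; split.
  move=> P /uniform_nbhs[E []]; rewrite -entourage_ballE => -[e /= e0 eE] HE.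
  have := near_infty_natSinv_lt (PosNum e0); apply: filterS => n /= ne.
  apply: HE => t /= /sab tab; apply: eE; rewrite /= /ball/= distrC.
  by rewrite (le_lt_trans (Hp n t tab)).
apply: (squeeze_cvgr _ (cvg_cst (0 : R)) d0); apply: nearW => n.
rewrite opnorm_ge0 opnorm_le// ?mulrn_wge0// => x.
by rewrite !bopE.
Qed.

Lemma cfc_approx_selfadjoint T g S : selfadjoint T -> cfc_approx T g S ->
  selfadjoint S.
Proof.
move=> sT TS; have rS x y : rdot (S x) y = rdot x (S y).
  apply/eqP; rewrite -subr_eq0 -normr_eq0 eq_le normr_ge0 andbT.
  (* Two errors of at most [(e / c) |x| |y|] must add up to at most [e]; the summand 1 keeps [c]
     positive. *)
  apply/ler_addgt0Pr => e e0; pose c := 2 * (rnorm x * rnorm y) + 1.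
  have c0 : 0 < c by rewrite ltr_wpDl// !mulr_ge0 ?rnorm_ge0.
  have [|p [_ Hp]] := TS (e / c); first by rewrite divr_gt0.
  have sp := selfadjoint_rdot (selfadjoint_poly_op p sT).
  have -> : rdot (S x) y - rdot x (S y) =
     rdot x (poly_op T p y - S y) - rdot (poly_op T p x - S x) y.
    by rewrite rdotBl rdotBr sp; ring.
  rewrite add0r (le_trans (ler_normB _ _))//.
  apply: (@le_trans _ _ (e / c * (2 * (rnorm x * rnorm y)))); last first.
    by rewrite -mulrA ler_piMr ?(ltW e0)// mulrC ler_pdivrMr// mul1r lerDl.
  rewrite mulrCA mulr_natl mulr2n lerD//.
    rewrite (le_trans (rdot_CS _ _))// mulrCA ler_wpM2l ?rnorm_ge0//.
  by rewrite (le_trans (rdot_CS _ _))// mulrA ler_wpM2r ?rnorm_ge0.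
move=> x y; apply/eqP; rewrite eq_complex; apply/andP; split; apply/eqP.
  exact: rS.
(* The real identity at [i x] is the identity of imaginary parts at [x]. *)
have := rS ('i%C *: x) y; rewrite bopZ /rdot !hdotZl.
case: (hdot _ _) (hdot _ _) => [? ?] [? ?] /=; lra.
Qed.

(** An approximating [p] is at least [- e / c] on the spectrum, so [p + e / c] gives a positive
    operator; [<S x, x>] then falls below 0 by at most [2 (e / c) |x|^2 <= e]. *)
Lemma cfc_approx_posop T g S : selfadjoint T -> cfc_approx T g S ->
  (forall t, spectrum T t%:C -> 0 <= g t) -> posop S.
Proof.
move=> sT TS g0; apply/selfadjoint_posop;
  first exact: cfc_approx_selfadjoint TS.
move=> x; apply/ler_addgt0Pr => e e0; pose c := 2 * rnorm x ^+ 2 + 1.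
have c0 : 0 < c by rewrite ltr_wpDl// mulr_ge0 ?sqr_ge0.
have ec0 : 0 < e / c by rewrite divr_gt0.
have [p [pg Hp]] := TS _ ec0.
have /posop_rdot/(_ x) : posop (poly_op T (p + (e / c)%:P)).
  apply: posop_poly_op => // t Tt; rewrite !hornerE.
  have := pg t Tt; have := g0 t Tt; rewrite ler_norml => ? /andP[? _]; lra.
rewrite poly_opD poly_opC !bopE rdotDl rdotZl rdotxx.
have : `|rdot (poly_op T p x - S x) x| <= e / c * rnorm x ^+ 2.
  by rewrite (le_trans (rdot_CS _ _))// expr2 mulrA ler_wpM2r ?rnorm_ge0.
rewrite rdotBl ler_norml => /andP[_].
have : e / c * (2 * rnorm x ^+ 2) <= e.
  by rewrite -mulrA ler_piMr ?(ltW e0)// mulrC ler_pdivrMr// mul1r lerDl.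
rewrite mulrCA; lra.
Qed.

Lemma cfc_approx_poly T (p : {poly R}) : cfc_approx T (horner p) (poly_op T p).
Proof.
move=> e e0; exists p; split=> [t _|x]; first by rewrite subrr normr0 ltW.
by rewrite subrr rnorm0 mulr_ge0 ?rnorm_ge0 ?ltW.
Qed.

(** With the companion rules for polynomials, scalars and multiplication by [t], this reduces an
    operator inequality to a scalar one on the spectrum, by [cfc_approx_posop]. *)
Lemma cfc_approxD T g h S U : cfc_approx T g S -> cfc_approx T h U ->
  cfc_approx T (fun t => g t + h t) (S + U).
Proof.
move=> TS TU e e0; have e20 : 0 < e / 2 by rewrite divr_gt0.
have [p [pg pS]] := TS _ e20; have [q [qh qU]] := TU _ e20.
exists (p + q); split=> [t Tt|x].
  rewrite hornerD opprD addrACA (le_trans (ler_normD _ _))//.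
  by rewrite (splitr e) lerD ?pg ?qh.
rewrite poly_opD !bopE opprD addrACA (le_trans (rnormD _ _))//.
by rewrite (splitr e) mulrDl lerD.
Qed.

Lemma cfc_approxZ T g S (c : R) : cfc_approx T g S ->
  cfc_approx T (fun t => c * g t) (c%:C *: S).
Proof.
move=> TS e e0; have c0 : 0 < `|c| + 1 by rewrite ltr_wpDl.
have [|p [pg pS]] := TS (e / (`|c| + 1)); first by rewrite divr_gt0.
have ce : `|c| * (e / (`|c| + 1)) <= e.
  by rewrite mulrCA ler_piMr ?(ltW e0)// ler_pdivrMr// mul1r lerDl.
exists (c *: p); split=> [t Tt|x].
  by rewrite hornerZ -mulrBr normrM (le_trans _ ce)// ler_wpM2l// pg.
rewrite poly_opZ !bopE -scalerBr rnormZ.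
by rewrite (le_trans (ler_wpM2l _ (pS x)))// mulrA ler_wpM2r ?rnorm_ge0.
Qed.

(** This is the product needed for [f'(A_i) A_i]. The bound [L] controls [|t|] on the spectrum, [M]
    controls [T] on vectors, and precision [e / (L + M)] serves both. *)
Lemma cfc_approxMX T g S : selfadjoint T -> cfc_approx T g S ->
  cfc_approx T (fun t => g t * t) (S * T).
Proof.
move=> sT TS e e0; have [L L0 HL] := rdot_bounded T;
  have [M M0 HM] := bop_rbounded T.
have N0 : 0 < L + M by rewrite addr_gt0.
have [|p [pg pS]] := TS (e / (L + M)); first by rewrite divr_gt0.
have LN : e / (L + M) * L <= e.
  by rewrite -mulrA ler_piMr ?(ltW e0)// mulrC ler_pdivrMr// mul1r lerDl ltW.
have MN : e / (L + M) * M <= e.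
  by rewrite -mulrA ler_piMr ?(ltW e0)// mulrC ler_pdivrMr// mul1r lerDr ltW.
exists (p * 'X); split=> [t Tt|x].
  have tL : `|t| <= L.
    rewrite ler_norml; apply/andP; split.
      apply: spectrum_ge Tt => // x; rewrite mulNr.
      by have := HL x; rewrite ler_norml => /andP[].
    by apply: spectrum_le Tt => // x; rewrite (le_trans (ler_norm _)).
  rewrite hornerMX -mulrBl normrM (le_trans _ LN)// ler_pM// pg//.
rewrite poly_opM poly_opX !bopE (le_trans (pS _))//.
rewrite (le_trans (ler_wpM2l _ (HM x))) ?divr_ge0 ?(ltW e0) ?(ltW N0)//.
by rewrite mulrA ler_wpM2r ?rnorm_ge0.
Qed.

End operators.

(** * Operators with spectrum in an interval *)

Section spectrum_in.
Context {R : realType} {H : hilbertType R}.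
Implicit Types (T : 'B(H)) (J : interval R).

Lemma posop_unit T : selfadjoint T ->
  (forall x, rnorm x = 1 -> 0 <= rdot (T x) x) -> posop T.
Proof.
move=> sT HT; apply/selfadjoint_posop => // x.
have [->|x0] := eqVneq x 0; first by rewrite rdotC rdot0l.
have nx : 0 < rnorm x by rewrite rnorm_gt0.
have := HT ((rnorm x)^-1%:C *: x); rewrite bopZ rdotZl rdotZr.
rewrite !pmulr_rge0 ?invr_gt0//; apply.
by rewrite rnormZ ger0_norm ?invr_ge0 ?rnorm_ge0// mulVf// gt_eqF.
Qed.

Lemma posop_sum (I : Type) (r : seq I) (F : I -> 'B(H)) :
  (forall i, posop (F i)) -> posop (\sum_(i <- r) F i).
Proof.
move=> pF; apply: (big_ind (@posop R H)) => //.
- by move=> x; rewrite bopE hdot0l.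
- by move=> S T pS pT x; rewrite bopE hdotDl addr_ge0.
Qed.

(** The extreme values of the numerical range belong to the spectrum, hence to [J]; this gives a
    compact interval inside [J] even when [J] is open or unbounded. *)
Lemma spectrum_in_bounds T J : (exists x : H, x != 0) -> selfadjoint T ->
  spectrum_in T J -> exists ab : R * R, [/\ ab.1 \in J, ab.2 \in J &
    forall x, ab.1 * rnorm x ^+ 2 <= rdot (T x) x <= ab.2 * rnorm x ^+ 2].
Proof.
move=> H0 sT TJ; have [a /TJ[s /= sJ /complexI sa] Ha] :=
  selfadjoint_inf_spectrum sT H0.
have [b /TJ[t /= tJ /complexI tb] Hb] := selfadjoint_sup_spectrum sT H0.
exists (a, b); split => [||x]; rewrite -?sa -?tb//=.
by rewrite sa tb Ha Hb.
Qed.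

(** The spectrum lies in [[a, b]], contained in [J], where [g] is continuous; a limit therefore
    exists and [xget] does not return its default 0. *)
Lemma cfcP T (a b : R) J g : selfadjoint T -> a \in J -> b \in J ->
  (forall x, a * rnorm x ^+ 2 <= rdot (T x) x <= b * rnorm x ^+ 2) ->
  {within [set` J], continuous g} -> cfc_approx T g (cfc T g).
Proof.
move=> sT aJ bJ Tab cg; apply: cfc_lim_approx; apply: (xgetPex 0).
apply: (@cfc_lim_exists _ _ _ _ a b) => //.
  move=> t Tt; apply/andP; split.
    by apply: spectrum_ge Tt => // x; have /andP[] := Tab x.
  by apply: spectrum_le Tt => // x; have /andP[] := Tab x.
apply: continuous_subspaceW cg => t /=; rewrite in_itv/=.
exact: (@interval_is_interval _ J a b).
Qed.

End spectrum_in.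

(** * Positive linear maps *)

Section positive_map.
Context {R : realType} {H K : hilbertType R}.
Context (Phi : {linear 'B(H) -> 'B(K)}) (Phi_pos : positive_map Phi).

(** For large [M] the operator [T + M] is positive, and [Phi T] is [Phi (T + M) - M Phi 1], a
    difference of self-adjoint operators. *)
Lemma positive_map_selfadjoint T : selfadjoint T -> selfadjoint (Phi T).
Proof.
move=> sT; have [M M0 HM] := rdot_bounded T.
have pT : posop (T + M%:C *: (1 : 'B(H))).
  apply/selfadjoint_posop.
    by apply: selfadjointD => //; exact: selfadjointZ.
  move=> x; rewrite !bopE rdotDl rdotZl rdotxx.
  by have := HM x; rewrite ler_norml => /andP[? _]; lra.
have := posop_selfadjoint (Phi_pos pT).
rewrite linearD linearZ/= => sP.
rewrite -(addrK (M%:C *: Phi 1) (Phi T)).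
by apply: selfadjointB => //;
  exact/selfadjointZ/posop_selfadjoint/Phi_pos/posop1.
Qed.

End positive_map.

(** The maps are applied to the positive operators [B i - a]; unitality turns the sum of the
    [a Phi_i(1)] into [a]. With the upper bound, this keeps the numerical range of the sum in
    [J]. *)
Lemma unital_sum_ge (R : realType) (H K : hilbertType R) (n : nat)
    (Phi : 'I_n -> {linear 'B(H) -> 'B(K)}) (B : 'I_n -> 'B(H)) (a : R) :
  (forall i, positive_map (Phi i)) -> \sum_(i < n) Phi i 1 = 1 ->
  (forall i, selfadjoint (B i)) ->
  (forall i x, a * rnorm x ^+ 2 <= rdot (B i x) x) ->
  forall x, a * rnorm x ^+ 2 <= rdot ((\sum_(i < n) Phi i (B i)) x) x.
Proof.
move=> Phi_pos Phi1 sB aB x.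
have : posop (\sum_(i < n) Phi i (B i - a%:C *: (1 : 'B(H)))).
  apply: posop_sum => i; apply: Phi_pos; apply/selfadjoint_posop.
    by apply: selfadjointB => //; exact: selfadjointZ.
  by move=> y; rewrite !bopE rdotBl rdotZl rdotxx subr_ge0.
move=> /posop_rdot/(_ x); under eq_bigr do rewrite linearB linearZ/=.
by rewrite sumrB -scaler_sumr Phi1 !bopE rdotBl rdotZl rdotxx subr_ge0.
Qed.

Lemma unital_sum_le (R : realType) (H K : hilbertType R) (n : nat)
    (Phi : 'I_n -> {linear 'B(H) -> 'B(K)}) (B : 'I_n -> 'B(H)) (b : R) :
  (forall i, positive_map (Phi i)) -> \sum_(i < n) Phi i 1 = 1 ->
  (forall i, selfadjoint (B i)) ->
  (forall i x, rdot (B i x) x <= b * rnorm x ^+ 2) ->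
  forall x, rdot ((\sum_(i < n) Phi i (B i)) x) x <= b * rnorm x ^+ 2.
Proof.
move=> Phi_pos Phi1 sB Bb x.
have := @unital_sum_ge R H K n Phi (fun i => - B i) (- b) Phi_pos Phi1.
under eq_bigr do rewrite linearN; rewrite sumrN.
move=> /(_ _ _ x); rewrite bopE rdotNl mulNr lerN2; apply.
  by move=> i; exact: selfadjointN.
by move=> i y; rewrite bopE rdotNl mulNr lerN2.
Qed.

(** * The operator inequality *)

Theorem corollary2p4 (R : realType) (H K : hilbertType R) (n : nat)
    (Phi : 'I_n -> {linear 'B(H) -> 'B(K)})
    (A B : 'I_n -> 'B(H)) (J : interval R) (f : R -> R)
    (Phi_pos : forall i, positive_map (Phi i))
    (Phi_unital : \sum_(i < n) Phi i 1 = 1)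
    (A_sa : forall i, selfadjoint (A i))
    (B_sa : forall i, selfadjoint (B i))
    (A_J : forall i, spectrum_in (A i) J)
    (B_J : forall i, spectrum_in (B i) J)
    (f_C1co : C1co J f) :
  let f' := derive_in J f in
  let theta : R := sup [set complex.Re
      (hdot ((\sum_(i < n) Phi i (cfc (A i) f' * A i)) x) x
       - hdot ((\sum_(i < n) Phi i (cfc (A i) f')) x) x
         * hdot ((\sum_(i < n) Phi i (B i)) x) x) | x in [set x : K | `|x| = 1]] in
  leop (\sum_(i < n) Phi i (cfc (A i) f))
       (cfc (\sum_(i < n) Phi i (B i)) f + theta%:C *: (1 : 'B(K))).
Proof.
move=> f' theta.
(* The space [K = 0] is treated apart. A nonzero vector of [K] forces, through unitality, a nonzero
   [H] and a nonempty index set. *)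
have [K0|/existsNP[y0 /eqP y00]] := pselect (forall x : K, x = 0).
  by move=> x; rewrite (K0 x) hdot0r.
have H0 : exists x : H, x != 0.
  apply/not_existsP => H0; case/eqP: y00.
  have -> : y0 = (\sum_(i < n) Phi i 1) y0 by rewrite Phi_unital.
  rewrite big1 ?bopE// => i _; rewrite (_ : 1 = 0) ?linear0//.
  by apply: bop_eq => x; apply/eqP; have := H0 (x - 0);
    rewrite subr0 => /negP; rewrite negbK.
have i0 : 'I_n.
  case: n Phi Phi_unital {A B Phi_pos A_sa B_sa A_J B_J theta}; last first.
    by move=> m *; exact: ord0.
  move=> Phi Phi1; exfalso; case/eqP: y00.
  have -> : y0 = (\sum_(i < 0) Phi i 1) y0 by rewrite Phi1.
  by rewrite big_ord0.
have Abd i := spectrum_in_bounds H0 (A_sa i) (A_J i).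
have /choice[ab Hab] := fun i => spectrum_in_bounds H0 (B_sa i) (B_J i).
(* The common bound is the least of finitely many lower bounds, so it is still a point of [J]. *)
have [a aJ Ha] :
    exists2 a, a \in J & forall i x, a * rnorm x ^+ 2 <= rdot (B i x) x.
  have [j _ jmin] := arg_minP (fun i => (ab i).1) (isT : xpredT i0).
  exists (ab j).1 => [|i x]; first by case: (Hab j).
  case: (Hab i) => _ _ /(_ x)/andP[+ _]; apply: le_trans.
  by rewrite ler_wpM2r ?sqr_ge0// jmin.
have [b bJ Hb] :
    exists2 b, b \in J & forall i x, rdot (B i x) x <= b * rnorm x ^+ 2.
  have [j _ jmax] := arg_maxP (fun i => (ab i).2) (isT : xpredT i0).
  exists (ab j).2 => [|i x]; first by case: (Hab j).
  case: (Hab i) => _ _ /(_ x)/andP[_ /le_trans]; apply.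
  by rewrite ler_wpM2r ?sqr_ge0//; exact: jmax.
set S := \sum_(i < n) Phi i (B i).
have sPhi i T : selfadjoint T -> selfadjoint (Phi i T).
  exact: positive_map_selfadjoint.
have sS : selfadjoint S by apply: selfadjoint_sum => i; apply: sPhi.
have Sab x : a * rnorm x ^+ 2 <= rdot (S x) x <= b * rnorm x ^+ 2.
  by rewrite unital_sum_ge// unital_sum_le.
have cf := C1co_continuous f_C1co; have cf' := C1co_derive_continuous f_C1co.
have fA i : cfc_approx (A i) f (cfc (A i) f).
  by have [c [cJ dJ Hc]] := Abd i; exact: (cfcP (A_sa i) cJ dJ Hc cf).
have f'A i : cfc_approx (A i) f' (cfc (A i) f').
  by have [c [cJ dJ Hc]] := Abd i; exact: (cfcP (A_sa i) cJ dJ Hc cf').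
have fS : cfc_approx S f (cfc S f) := cfcP sS aJ bJ Sab cf.
set X := \sum_(i < n) Phi i (cfc (A i) f' * A i) in theta *.
set Y := \sum_(i < n) Phi i (cfc (A i) f') in theta *.
set Z := \sum_(i < n) Phi i (cfc (A i) f).
have sfS : selfadjoint (cfc S f) := cfc_approx_selfadjoint sS fS.
have sZ : selfadjoint Z.
  by apply: selfadjoint_sum => i; apply: sPhi;
    apply: cfc_approx_selfadjoint (fA i).
(* Since [<S x, x>] is real, the real part of the product is the product of the real parts. *)
have thetaE x : complex.Re (hdot (X x) x - hdot (Y x) x * hdot (S x) x) =
    rdot (X x) x - rdot (Y x) x * rdot (S x) x.
  rewrite (selfadjoint_hdotE sS) /rdot.
  by case: (hdot (X x) x) (hdot (Y x) x) => [? ?] [? ?] /=; rewrite mulr0 subr0.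
have theta_ge x : rnorm x = 1 ->
  rdot (X x) x - rdot (Y x) x * rdot (S x) x <= theta.
  move=> x1; rewrite -thetaE; apply: ub_le_sup; last first.
    by exists x => //=; rewrite rnormE x1.
  (* Boundedness of [X], [Y] and [S] bounds the set above, so that [sup] is a true supremum. *)
  have [MX _ HX] := rdot_bounded X; have [MY MY0 HY] := rdot_bounded Y.
  have [MS _ HS] := rdot_bounded S; exists (MX + MY * MS) => _ [y /= y1 <-].
  have {}y1 : rnorm y = 1 by rewrite /rnorm y1.
  rewrite thetaE (le_trans (ler_norm _))// (le_trans (ler_normB _ _))//.
  have := HX y; have := HY y; have := HS y;
    rewrite y1 expr1n !mulr1 => HS' HY' HX'.
  by rewrite lerD// normrM ler_pM.
apply: posop_unit.
  by apply: selfadjointB => //; apply: selfadjointD => //; exact: selfadjointZ.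
move=> x x1; set t := rdot (S x) x.
have tJ : t \in J.
  have := Sab x; rewrite x1 expr1n !mulr1;
    exact: (@interval_is_interval _ J a b).
have S_spec s : spectrum S s%:C -> s \in J.
  move=> Ss; apply: (@interval_is_interval _ J a b) => //; apply/andP; split.
    by apply: spectrum_ge Ss => // y; have /andP[] := Sab y.
  by apply: spectrum_le Ss => // y; have /andP[] := Sab y.
have A_spec i s : spectrum (A i) s%:C -> s \in J.
  by move=> /(A_J i)[u /= uJ /complexI <-].
have jensen : f t <= rdot (cfc S f x) x.
  (* [f + q] is the gap between [f] and its tangent at [t]. At the vector [x] the linear terms
     cancel, because [<S x, x> = t]. *)
  pose q : {poly R} := (- f' t) *: 'X + (f' t * t - f t)%:P.
  have /posop_rdot/(_ x) : posop (cfc S f + poly_op S q).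
    apply: (cfc_approx_posop sS (cfc_approxD fS (cfc_approx_poly S q))).
    move=> s /S_spec sJ.
    by have := C1co_tangent f_C1co tJ sJ;
      rewrite hornerD hornerZ hornerX hornerC -/f'; lra.
  rewrite poly_opD poly_opZ poly_opX poly_opC !bopE !rdotDl !rdotZl rdotxx x1.
  by rewrite -/t expr1n; lra.
have main : rdot (Z x) x <= f t + rdot (X x) x - rdot (Y x) x * t.
  (* [W i] is the calculus of [s |-> f t + f' s s - t f' s - f s], nonnegative by the tangent
     inequality at [s] evaluated at [t]. *)
  pose W i := (poly_op (A i) (f t)%:P + cfc (A i) f' * A i)
    + ((- t)%:C *: cfc (A i) f' + (-1)%:C *: cfc (A i) f).
  have /posop_rdot/(_ x) : posop (\sum_(i < n) Phi i (W i)).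
    apply: posop_sum => i; apply: Phi_pos.
    have W1 := cfc_approxD (cfc_approx_poly (A i) (f t)%:P)
      (cfc_approxMX (A_sa i) (f'A i)).
    have W2 := cfc_approxD (cfc_approxZ (- t) (f'A i)) (cfc_approxZ (-1) (fA i)).
    apply: (cfc_approx_posop (A_sa i) (cfc_approxD W1 W2)).
    move=> s /A_spec sJ; have := C1co_tangent f_C1co sJ tJ;
      rewrite hornerC -/f'; lra.
  have -> : \sum_(i < n) Phi i (W i) =
      (f t)%:C *: (1 : 'B(K)) + X + ((- t)%:C *: Y + (-1)%:C *: Z).
    rewrite -Phi_unital !scaler_sumr -!big_split; apply: eq_bigr => i _.
    by rewrite /W poly_opC !linearD !linearZ.
  rewrite !bopE !rdotDl !rdotZl rdotxx x1 expr1n; lra.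
rewrite !bopE rdotBl rdotDl rdotZl rdotxx x1 expr1n mulr1.
by have := theta_ge x x1; rewrite -/t; lra.
Qed.
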